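(* Let $\{c_j\}_{j\ge 0}$ be independent standard (real) Gaussian random variables, let $C_n=\mathrm{Circ}(c_0,c_1,\dots,c_{n-1})$, let $\theta\in[-\pi,\pi]$, and let $D_n(\theta)=\mathrm{diag}(1,\eta,\eta^2,\dots,\eta^{n-1})$ with $\eta=e^{\iota\theta/n}$. Then there exist an NCP $(\mathcal{A},\varphi)$ and elements $N,d(\theta)\in\mathcal{A}$ such that for every monomial $Q\in\mathbb{C}\langle x_1,x_2\rangle$, $$\lim_{n\to\infty}\varphi_n\big(Q(n^{-1/2}C_n,\,D_n(\theta))\big)=\varphi\big(Q(N,d(\theta))\big),$$ where the $*$-moments of $N$ are those of a standard complex Gaussian variable, and the $*$-distribution of $d(\theta)$ is that of $e^{\iota\theta U}$ with $U\sim Uniform(0,1)$, i.e. $\varphi(m(d(\theta)))=\mathbb{E}[m(e^{\iota\theta U})]$ for every monomial $m\in\mathbb{C}\langle x\rangle$.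
   Context: $\iota=\sqrt{-1}$. An NCP (non-commutative $*$-probability space) $(\mathcal{A},\varphi)$ is a unital complex $*$-algebra $\mathcal{A}$ with a complex linear functional $\varphi$ (called a state) satisfying $\varphi(1_{\mathcal{A}})=1$. $\mathbb{C}\langle x_1,\dots,x_p\rangle$ denotes the set of complex monomials in the non-commuting indeterminates $x_1,x_1^*,\dots,x_p,x_p^*$. $\mathcal{M}_n$ is the $*$-algebra of $n\times n$ random matrices all of whose entries have finite moments of all orders, with state $\varphi_n=n^{-1}\mathbb{E}\,\mathrm{Tr}(\cdot)$; $*$ is conjugate transpose. The circulant matrix is $\mathrm{Circ}(c_0,\dots,c_{n-1})=((c_{(j-i+n)\,\mathrm{mod}\,n}))_{0\le i,j\le n-1}$. A variable $a\in\mathcal{A}$ is a standard complex Gaussian variable if it is normal ($aa^*=a^*a$) and $\varphi(a^k a^{*l})=\mathbb{E}[G^k\overline{G}^{\,l}]$ for all $k,l\ge 0$, where $G=X+\iota Y$ with $X,Y$ independent real Gaussian random variables of mean $0$ and variance $1/2$. *)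

(* Defs.v *)
From HB Require Import structures.
From mathcomp Require Import all_boot all_order all_algebra.
From mathcomp Require Import finmap.
From mathcomp.real_closed Require Import complex.
From mathcomp Require Import all_classical all_reals all_analysis.
Set Implicit Arguments.
Unset Strict Implicit.
Unset Printing Implicit Defensive.
Import Order.TTheory GRing.Theory Num.Theory.
Import numFieldNormedType.Exports.
Local Open Scope classical_set_scope.
Local Open Scope ring_scope.
Local Open Scope complex_scope.

HB.mixin Record isStarAlgebra (C : numClosedFieldType) A
    of GRing.Algebra C A := {
  star : A -> A;
  starK : involutive star;
  starD : {morph star : x y / x + y};
  starZ : forall (k : C) x, star (k *: x) = Num.conj k *: star x;
  starM : forall x y, star (x * y) = star y * star x
}.

#[short(type="starAlgType")]
HB.structure Definition StarAlgebra (C : numClosedFieldType) :=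
  {A of isStarAlgebra C A & GRing.Algebra C A}.

Section ScalarStar.
Variable C : numClosedFieldType.

Let conj_star (x : C^o) : C^o := Num.conj x.

Let conj_starK : involutive conj_star.
Proof. exact: conjCK. Qed.

Let conj_starD : {morph conj_star : x y / x + y}.
Proof. exact: rmorphD. Qed.

Let conj_starZ (k : C) (x : C^o) :
  conj_star (k *: x) = Num.conj k *: conj_star x.
Proof. exact: rmorphM. Qed.

Let conj_starM (x y : C^o) : conj_star (x * y) = conj_star y * conj_star x.
Proof. by rewrite mulrC; exact: rmorphM. Qed.

HB.instance Definition _ := isStarAlgebra.Build C C^o
  conj_starK conj_starD conj_starZ conj_starM.

End ScalarStar.

Section MatrixStar.
Variables (C : numClosedFieldType) (n : nat).
Local Notation M := 'M[C]_n.+1.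

Definition ctrmx (A : M) : M := map_mx Num.conj A^T.

Let ctrmxK : involutive ctrmx.
Proof. by move=> A; apply/matrixP => i j; rewrite !mxE conjCK. Qed.

Let ctrmxD : {morph ctrmx : A B / A + B}.
Proof. by move=> A B; apply/matrixP => i j; rewrite !mxE rmorphD. Qed.

Let ctrmxZ (k : C) (A : M) : ctrmx (k *: A) = Num.conj k *: ctrmx A.
Proof. by apply/matrixP => i j; rewrite !mxE rmorphM. Qed.

Let ctrmxM (A B : M) : ctrmx (A * B) = ctrmx B * ctrmx A.
Proof. by rewrite /ctrmx trmx_mul map_mxM. Qed.

HB.instance Definition _ := isStarAlgebra.Build C M
  ctrmxK ctrmxD ctrmxZ ctrmxM.

End MatrixStar.

(* No positivity, traciality or faithfulness is required of the state. *)
Record ncProbSpace (C : numClosedFieldType) := NCProbSpace {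
  ncp_alg :> starAlgType C;
  state : {scalar ncp_alg};
  state1 : state 1 = 1 }.
Arguments state {C} n.

Definition normal_elt (C : numClosedFieldType) (A : starAlgType C) (a : A) :=
  a * star a = star a * a.

(* The monomial (k, [:: l_1; ...; l_r]) is k l_1 ... l_r, where the letter
   (i, false) stands for x_i and (i, true) for x_i^*. *)
Definition monomial (C : numClosedFieldType) (p : nat) :=
  (C * seq ('I_p * bool))%type.

Definition meval (C : numClosedFieldType) (A : starAlgType C) (p : nat)
    (Q : monomial C p) (a : p.-tuple A) : A :=
  Q.1 *: \prod_(l <- Q.2) (if l.2 then star (tnth a l.1) else tnth a l.1).

Section ComplexProbability.
Context d (T : measurableType d) (R : realType) (P : probability T R).

Definition cexpectation (Z : T -> R[i]) : R[i] :=
  fine 'E_P[fun w => complex.Re (Z w)] +i*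
  fine 'E_P[fun w => complex.Im (Z w)].

(* The state n^-1 E Tr on random n x n matrices. The *-algebra operations on
   random matrices are pointwise, so Q(M_1, ..., M_p) is the random matrix
   w |-> Q(M_1(w), ..., M_p(w)). *)
Definition phi (n : nat) (M : T -> 'M[R[i]]_n) : R[i] :=
  n%:R^-1 * cexpectation (fun w => \tr (M w)).

Definition mutually_independent (X : nat -> {RV P >-> R}) : Prop :=
  forall (J : {fset nat}) (B : nat -> set R),
    (forall j, measurable (B j)) ->
    P (\bigcap_(j in [set` J]) (X j @^-1` B j)) =
    (\prod_(j <- J) P (X j @^-1` B j))%E.

Definition standard_gaussian (X : {RV P >-> R}) : Prop :=
  forall B : set R, measurable B -> distribution P X B = normal_prob 0 1 B.

Definition circ (n : nat) (c : nat -> R) : 'M[R[i]]_n :=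
  \matrix_(i, j) (c ((j + n - i) %% n)%N)%:C.

End ComplexProbability.

Section Model.
Variable R : realType.

Definition expi (t : R) : R[i] := cos t +i* sin t.

Definition Dmx (n : nat) (theta : R) : 'M[R[i]]_n :=
  diag_mx (\row_j expi (theta / n%:R) ^+ j).

(* The joint law of two independent real Gaussian variables of mean 0 and
   variance 1/2 (normal_prob takes the standard deviation). *)
Definition gauss2 :=
  (normal_prob (0 : R) (Num.sqrt 2^-1) \x normal_prob (0 : R) (Num.sqrt 2^-1))%E.

Definition std_complex_gaussian (A : ncProbSpace R[i]) (a : A) : Prop :=
  normal_elt a /\
  forall k l : nat, state A (a ^+ k * star a ^+ l) =
    cexpectation gauss2
      (fun w => (w.1 +i* w.2) ^+ k * Num.conj (w.1 +i* w.2) ^+ l).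

Definition uniform01 : probability _ R := uniform_prob (@ltr01 R).

End Model.

(* Main.v *)
Require Import Defs.
From HB Require Import structures.
From mathcomp Require Import all_boot all_order all_algebra.
From mathcomp Require Import finmap monalg.
From mathcomp Require Import ring zify.
From mathcomp.real_closed Require Import complex.
From mathcomp Require Import all_classical all_reals all_analysis.
From mathcomp Require Import measurable_realfun.
Set Implicit Arguments.
Unset Strict Implicit.
Unset Printing Implicit Defensive.
Import Order.TTheory GRing.Theory Num.Theory.
Import numFieldNormedType.Exports.
Local Open Scope classical_set_scope.
Local Open Scope ring_scope.
Local Open Scope complex_scope.

(** The trace of a word in C_n and D_n is a sum over closed walks on the cycle
    Z/n. A circulant letter moves the walk by some amount a, forwards, or
    backwards for the adjoint, and contributes the Gaussian variable c_a; a
    diagonal letter leaves the walk where it is and contributes the phase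
    exp(iota theta x), or its conjugate, where x in [0, 1) is the position
    divided by n ([word_entry]). Wick's formula ([gaussian_wick]) turns the
    expectation into a sum over the pairings of the circulant letters, the two
    letters of a pair making moves of the same length ([phi_word]). For 2 h
    circulant letters the normalisation n^(- h - 1) is the inverse of the number
    of choices of a starting point and of one move for each pair, so that a
    pairing contributes the average of a product of phases, restricted to the
    walks that close ([pair_term]).

    Call a pairing balanced if each pair joins a letter C_n to a letter adjoint
    to C_n. The moves of an unbalanced pairing satisfy a nontrivial congruence
    modulo n when the walk closes, which makes its contribution O(1/n)
    ([pair_term_unbalanced]). For a balanced pairing every walk closes, and the
    contribution is a full average of phases ([pair_term_balanced]). That this
    average converges is shown without identifying the limit, a multiple
    integral. Passing from n to a multiple n m refines the grid, and the phases
    move by O(1/n), except where the walk passes near the origin of the cycle;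
    this happens for a proportion O(1/n) of the choices, as the starting point
    enters every position with coefficient one ([average_refine]). Comparing n
    and m with n m then gives the Cauchy property ([refine_cvg]).

    Hence every word has a limit. On the algebra of the free monoid with
    involution on two letters, each function with value 1 at the empty word
    extends to a state ([monoid_space]), and the limits are such a function.
    This defines the limit space; only its two marginals remain. For words in
    the circulant letters the phases are absent and the limit is the number of
    balanced pairings ([pair_term_circ]); the moments of the standard complex
    Gaussian variable are the same numbers, by Wick's formula for its two real
    coordinates ([complex_gaussian_moment]). For words in the diagonal letters
    the average is a Riemann sum for the moments of exp(iota theta U)
    ([pair_term_diag]). *)

(** * The algebra of a monoid with involution *)

HB.mixin Record isStarMonomial M of MonomialDef M := {
  mstar : M -> M;
  mstarK : involutive mstar;
  mstarM : forall x y, mstar (mmul x y) = mmul (mstar y) (mstar x)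
}.

#[short(type="starMonomType")]
HB.structure Definition StarMonomial := {M of isStarMonomial M & MonomialDef M}.

Section MonoidAlgebra.
Variables (C : numClosedFieldType) (M : starMonomType).

Section Extend.
Variables (V : nmodType) (f : M -> C -> V).
Hypothesis f0 : forall k, f k 0 = 0.
Hypothesis fD : forall k, {morph f k : x y / x + y}.

(** The maps [f k] are only additive: besides the linear states, the
    conjugate linear star is of this form. *)
Definition extend (g : {malg C[M]}) : V := \sum_(k <- msupp g) f k g@_k.

Lemma extendEw (D : {fset M}) (g : {malg C[M]}) : (msupp g `<=` D)%fset ->
  extend g = \sum_(k <- D) f k g@_k.
Proof.
move=> gD; rewrite /extend (big_fset_incl _ gD)// => k _ /mcoeff_outdom ->.
exact: f0.
Qed.

Lemma extendD : {morph extend : x y / x + y}.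
Proof.
move=> x y; rewrite (@extendEw (msupp x `|` msupp y)%fset (x + y)) ?msuppD_le//.
rewrite (@extendEw (msupp x `|` msupp y)%fset x) ?fsubsetUl//.
rewrite (@extendEw (msupp x `|` msupp y)%fset y) ?fsubsetUr//.
by rewrite -big_split; apply: eq_bigr => k _; rewrite /= mcoeffD fD.
Qed.

Lemma extendU k x : extend << x *g k >> = f k x.
Proof. by rewrite (extendEw msuppU_le) big_seq_fset1 mcoeffUU. Qed.

Lemma extend0 : extend 0 = 0.
Proof. by rewrite /extend msupp0 big_seq_fset0. Qed.

Lemma extend_sum (I : Type) (r : seq I) (h : I -> {malg C[M]}) :
  extend (\sum_(i <- r) h i) = \sum_(i <- r) extend (h i).
Proof. exact: (big_morph _ extendD extend0). Qed.

End Extend.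

(** A new name for the type, which gives a place to the algebra structure when
    [M] is not commutative. *)
Definition monoid_algebra := {malg C[M]}.
HB.instance Definition _ := GRing.Lalgebra.copy monoid_algebra {malg C[M]}.

Let scaleAr (c : C) (x y : {malg C[M]}) : c *: (x * y) = x * (c *: y).
Proof.
rewrite malgME (malgMEw (fsubset_refl _) (msuppZ_le c y)) scaler_sumr.
apply: eq_bigr => k _; rewrite scaler_sumr; apply: eq_bigr => l _.
by apply/malgP => j; rewrite mcoeffZ !mcoeffU mulrnAr mcoeffZ mulrCA.
Qed.

HB.instance Definition _ := GRing.Lalgebra_isAlgebra.Build C monoid_algebra scaleAr.

Definition malg_star (g : {malg C[M]}) : {malg C[M]} :=
  extend (fun k x => << Num.conj x *g mstar k >>) g.

Let star0 k : << Num.conj (0 : C) *g mstar k >> = 0 :> {malg C[M]}.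
Proof. by rewrite rmorph0 monalgU0. Qed.

Let starD_coef k : {morph (fun x : C => << Num.conj x *g mstar k >> : {malg C[M]}) :
  x y / x + y}.
Proof. by move=> x y; rewrite rmorphD monalgUD. Qed.

Let starD' : {morph malg_star : x y / x + y}.
Proof. exact: (extendD star0 starD_coef). Qed.

Let starU k x : malg_star << x *g k >> = << Num.conj x *g mstar k >>.
Proof. exact: (extendU star0). Qed.

Let star_sum (I : Type) (r : seq I) (h : I -> {malg C[M]}) :
  malg_star (\sum_(i <- r) h i) = \sum_(i <- r) malg_star (h i).
Proof. exact: (extend_sum star0 starD_coef). Qed.

Let starK' : involutive malg_star.
Proof.
move=> g; rewrite [in LHS](monalgE g) !star_sum [RHS]monalgE.
by apply: eq_bigr => k _; rewrite !starU conjCK mstarK.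
Qed.

Let starZ' (c : C) g : malg_star (c *: g) = Num.conj c *: malg_star g.
Proof.
rewrite malgZ_def /fgscale star_sum [in RHS]/malg_star /extend scaler_sumr.
apply: eq_bigr => k _; rewrite starU rmorphM.
by apply/malgP => j; rewrite mcoeffZ !mcoeffU mulrnAr.
Qed.

Let starM' g h : malg_star (g * h) = malg_star h * malg_star g.
Proof.
rewrite malgME star_sum [in RHS](monalgE g) [in RHS](monalgE h) !star_sum.
rewrite mulr_sumr; apply: eq_bigr => k _; rewrite star_sum mulr_suml.
apply: eq_bigr => l _; rewrite !starU malgM_def fgmulUU mstarM.
by rewrite rmorphM mulrC.
Qed.

HB.instance Definition _ := isStarAlgebra.Build C monoid_algebra
  starK' starD' starZ' starM'.

Definition gen (k : M) : monoid_algebra := << k >>.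

Lemma gen1 : gen mone = 1.
Proof. by []. Qed.

Lemma genM k l : gen k * gen l = gen (mmul k l).
Proof. by rewrite /gen [LHS]fgmulUU mulr1. Qed.

Lemma star_gen k : star (gen k) = gen (mstar k).
Proof. by rewrite [LHS]starU conjC1. Qed.

Section LinearState.
Variable tau : M -> C.

Definition linear_extension (g : monoid_algebra) : C :=
  extend (fun k x => x * tau k) g.

Let tau0 k : 0 * tau k = 0. Proof. exact: mul0r. Qed.
Let tauD k : {morph (fun x => x * tau k) : x y / x + y}.
Proof. by move=> x y; exact: mulrDl. Qed.

Let linear_extension_linear : linear_for *%R linear_extension.
Proof.
move=> c x y; rewrite [LHS](extendD tau0 tauD); congr (_ + _).
rewrite (extendEw tau0 (msuppZ_le c x)) mulr_sumr.
by apply: eq_bigr => k _; rewrite mcoeffZ mulrA.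
Qed.

HB.instance Definition _ := GRing.isLinear.Build C monoid_algebra C *%R
  linear_extension linear_extension_linear.

Lemma linear_extension_gen k : linear_extension (gen k) = tau k.
Proof. by rewrite [LHS](extendU tau0) mul1r. Qed.

Hypothesis tau1 : tau mone = 1.

(** A state is a linear form with value 1 at the unit, so the moments of a
    space can be prescribed on the monoid. *)
Definition monoid_space : ncProbSpace C :=
  @NCProbSpace C monoid_algebra linear_extension
    (etrans (linear_extension_gen mone) tau1).

End LinearState.

End MonoidAlgebra.

(** * Sums over a box *)

Section MultiSum.
Variable V : nmodType.
Implicit Types F G : seq nat -> V.

(** The indices form a list, since a walk on the cycle consumes them one at a
    time. *)
Fixpoint boxsum (n K : nat) F : V :=
  if K is K'.+1 then \sum_(a < n) boxsum n K' (fun s => F (val a :: s))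
  else F [::].

Definition below n (s : seq nat) := all (fun a => a < n)%N s.

Lemma eq_boxsum n K F G :
  (forall s, size s = K -> below n s -> F s = G s) -> boxsum n K F = boxsum n K G.
Proof.
elim: K F G => [|K IH] F G FG /=; first exact: FG.
apply: eq_bigr => a _; apply: IH => s sK sn.
by apply: FG; rewrite /= ?sK// ltn_ord.
Qed.

Lemma boxsum_sum (I : Type) (r : seq I) (Q : pred I) n K (F : I -> seq nat -> V) :
  boxsum n K (fun s => \sum_(i <- r | Q i) F i s) =
  \sum_(i <- r | Q i) boxsum n K (F i).
Proof.
elim: K F => [//|K IH] F /=; rewrite exchange_big/=.
by apply: eq_bigr => a _; rewrite IH.
Qed.

Lemma boxsum_recr n K F :
  boxsum n K.+1 F = boxsum n K (fun s => \sum_(a < n) F (val a :: s)).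
Proof. by rewrite boxsum_sum. Qed.

Lemma boxsumD n K F G :
  boxsum n K (fun s => F s + G s) = boxsum n K F + boxsum n K G.
Proof.
elim: K F G => [//|K IH] F G /=; rewrite -big_split/=.
by apply: eq_bigr => a _; rewrite IH.
Qed.

End MultiSum.

Section MultiSumRing.

Lemma boxsumMl (T : pzRingType) (c : T) n K F :
  boxsum n K (fun s => c * F s) = c * boxsum n K F.
Proof.
elim: K F => [//|K IH] F /=; rewrite mulr_sumr.
by apply: eq_bigr => a _; rewrite IH.
Qed.

Lemma boxsumB (V : zmodType) n K (F G : seq nat -> V) :
  boxsum n K (fun s => F s - G s) = boxsum n K F - boxsum n K G.
Proof.
elim: K F G => [//|K IH] F G /=; rewrite -sumrB.
by apply: eq_bigr => a _; rewrite IH.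
Qed.

Lemma boxsum_const (T : pzSemiRingType) (c : T) n K :
  boxsum n K (fun=> c) = c * (n ^ K)%:R.
Proof.
elim: K => [|K IH] /=; first by rewrite mulr1.
under eq_bigr do rewrite IH.
by rewrite sumr_const card_ord -[LHS]mulr_natr expnSr natrM mulrA.
Qed.

Lemma ler_boxsum (T : numDomainType) n K (F G : seq nat -> T) :
  (forall s, size s = K -> below n s -> F s <= G s) ->
  boxsum n K F <= boxsum n K G.
Proof.
elim: K F G => [|K IH] F G FG /=; first exact: FG.
apply: ler_sum => a _; apply: IH => s sK sn.
by apply: FG; rewrite /= ?sK// ltn_ord.
Qed.

Lemma ler_norm_boxsum (T : numDomainType) n K (F : seq nat -> T) :
  `|boxsum n K F| <= boxsum n K (fun s => `|F s|).
Proof.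
elim: K F => [//|K IH] F /=; apply: (le_trans (ler_norm_sum _ _ _)).
by apply: ler_sum => a _; apply: IH.
Qed.

Lemma boxsum_prod (T : comNzRingType) n K (G : nat -> nat -> T) :
  boxsum n K (fun u => \prod_(p < K) G p (nth 0%N u p)) =
  \prod_(p < K) \sum_(a < n) G p a.
Proof.
elim: K G => [|K IH] G /=; first by rewrite !big_ord0.
rewrite big_ord_recl/= big_distrl/=; apply: eq_bigr => a _.
rewrite -(IH (fun p => G p.+1)) -boxsumMl.
by apply: eq_boxsum => s _ _; rewrite big_ord_recl.
Qed.

End MultiSumRing.

(** * Pairings and Wick's formula *)

Section Pairings.

Definition insert (t x : nat) (s : seq nat) := take t s ++ x :: drop t s.
Definition delete (t : nat) (s : seq nat) := take t s ++ drop t.+1 s.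

(** A pairing of K positions is encoded by the list that carries at each
    position the number of its pair. Position 0 belongs to pair 0, [t] chooses
    its partner, and the pairs of the other positions are shifted by one. *)
Fixpoint pairings (K : nat) : seq (seq nat) :=
  match K with
  | 0 => [:: [::]]
  | 1 => [::]
  | K'.+2 => [seq 0%N :: insert t 0%N (map succn q) |
                t <- iota 0 K'.+1, q <- pairings K']
  end.

Lemma pairingsSS K :
  pairings K.+2 = [seq 0%N :: insert t 0%N (map succn q) |
                     t <- iota 0 K.+1, q <- pairings K].
Proof. by []. Qed.

Lemma nat_ind2 (Q : nat -> Prop) :
  Q 0%N -> Q 1%N -> (forall K, Q K -> Q K.+2) -> forall K, Q K.
Proof.
move=> Q0 Q1 QS K; suff: Q K /\ Q K.+1 by case.
by elim: K => // K [QK QK1]; split=> //; exact: QS.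
Qed.

Lemma pairings_size K (q : seq nat) : q \in pairings K -> size q = K /\ ~~ odd K.
Proof.
elim/nat_ind2: K q => [|//|K IH] q; first by rewrite inE => /eqP->.
case/allpairsP=> -[t r] /= [tK /IH[rK Ko] ->]; split=> /=; last by rewrite negbK.
by rewrite size_cat/= addnS -size_cat cat_take_drop size_map rK.
Qed.

Lemma pairings_count K (q : seq nat) (p : nat) :
  q \in pairings K -> count_mem p q = (p < K./2)%N.*2.
Proof.
elim/nat_ind2: K q p => [|//|K IH] q p; first by rewrite inE => /eqP->.
case/allpairsP=> -[t r] /= [tK rK ->] /=.
rewrite /insert count_cat/= [X in (_ + X)%N]addnCA -count_cat cat_take_drop count_map.
case: p => [|p].
  rewrite !eqxx (@eq_count _ _ pred0) ?count_pred0// => x /=.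
by rewrite !add0n -(IH _ p rK); apply: eq_count => x /=; rewrite eqSS.
Qed.

End Pairings.

Section Wick.
Variables (T : comNzRingType) (v : T) (mu : nat -> T).
Hypothesis mu0 : mu 0 = 1.
Hypothesis mu1 : mu 1 = 0.
Hypothesis muS : forall m, mu m.+2 = m.+1%:R * v * mu m.

(** The expectation of the product of the X_a, for a in [s], when X_0, ...,
    X_(n-1) are independent variables with moments [mu]. *)
Definition gmoment (n : nat) (s : seq nat) : T :=
  \prod_(j < n) mu (count_mem (val j) s).

Lemma perm_gmoment n s1 s2 : perm_eq s1 s2 -> gmoment n s1 = gmoment n s2.
Proof. by move=> /permP s12; apply: eq_bigr => j _; rewrite s12. Qed.

Lemma gmoment2 n a s : (a < n)%N ->
  gmoment n [:: a, a & s] = (count_mem a s).+1%:R * v * gmoment n s.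
Proof.
move=> an; rewrite /gmoment (bigD1 (Ordinal an))//= [in RHS](bigD1 (Ordinal an))//=.
rewrite eqxx/= !add1n muS -!mulrA; congr (_ * (_ * (_ * _))).
by apply: eq_bigr => j; rewrite -val_eqE/= eq_sym => /negbTE->.
Qed.

Lemma perm_delete t s : (t < size s)%N ->
  perm_eq s (nth 0%N s t :: delete t s).
Proof.
by move=> ts; rewrite -{1}(cat_take_drop t s) (drop_nth 0%N)// -cat1s perm_catCA.
Qed.

(** Gaussian integration by parts: the first variable is paired with each later
    occurrence of itself. By the recursion for [mu], each such occurrence
    contributes the same amount. *)
Lemma gmoment_cons n a s : (a < n)%N ->
  gmoment n (a :: s) =
  v * \sum_(t < size s) (nth 0%N s t == a)%:R * gmoment n (delete t s).
Proof.
move=> an; have [am|aNm] := boolP (a \in s); last first.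
  rewrite big1 ?mulr0 => [|t _]; last first.
    by case: eqP => [sta|]; rewrite ?mul0r//; rewrite -sta mem_nth in aNm.
  rewrite /gmoment (bigD1 (Ordinal an))//= eqxx.
  by rewrite (count_memPn aNm) mu1 mul0r.
have -> : gmoment n (a :: s) = (count_mem a s)%:R * v * gmoment n (rem a s).
  rewrite (@perm_gmoment _ _ [:: a, a & rem a s]) ?perm_cons ?perm_to_rem//.
  by rewrite gmoment2// (permP (perm_to_rem am))/= eqxx.
rewrite mulrAC [RHS]mulrC; congr (_ * _).
transitivity (\sum_(t < size s) (nth 0%N s t == a)%:R * gmoment n (rem a s)).
  rewrite -mulr_suml -natr_sum; congr (_%:R * _).
  by rewrite -sum1_count big_mkcond (big_nth 0%N) big_mkord; apply: eq_bigr.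
apply: eq_bigr => t _; case: eqP => [sta|]; rewrite ?mul0r// !mul1r.
apply/perm_gmoment; rewrite -(perm_cons a).
have := perm_delete (ltn_ord t); rewrite sta; apply: perm_trans.
by rewrite perm_sym perm_to_rem.
Qed.

Lemma boxsum_insert n K t a (H : seq nat -> T) : (a < n)%N -> (t <= K)%N ->
  boxsum n K.+1 (fun s => (nth 0%N s t == a)%:R * H s) =
  boxsum n K (fun s => H (insert t a s)).
Proof.
move=> an; elim: K t H => [|K IH] [|t] H //= tK.
- rewrite (bigD1 (Ordinal an))//= eqxx mul1r big1 ?addr0// => j.
  by rewrite -val_eqE/= => /negbTE->; rewrite mul0r.
- rewrite (bigD1 (Ordinal an))//= [X in _ + X]big1 ?addr0; last first.
    move=> j; rewrite -val_eqE/= => /negbTE ->.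
    by apply: big1 => k _; rewrite boxsumMl mul0r.
  by apply: eq_bigr => k _; apply: eq_boxsum => s _ _; rewrite eqxx mul1r.
- by apply: eq_bigr => k _; exact: (IH t (fun s => H (val k :: s))).
Qed.

Lemma delete_insert t a s : (t <= size s)%N -> delete t (insert t a s) = s.
Proof.
move=> ts; rewrite /delete /insert take_size_cat ?size_takel//.
by rewrite drop_cat size_takel// ltnNge leqnSn/= subSnn/= drop0 cat_take_drop.
Qed.

Lemma map_insert f t x s : map f (insert t x s) = insert t (f x) (map f s).
Proof. by rewrite /insert map_cat/= map_take map_drop. Qed.

(** Integration by parts pairs position 0 with a position t, whose index is
    then no longer free ([boxsum_insert]); the remaining K - 2 positions are
    paired by induction. *)
Theorem wick n K (F : seq nat -> T) :
  boxsum n K (fun s => F s * gmoment n s) =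
  v ^+ K./2 * \sum_(q <- pairings K)
     boxsum n K./2 (fun u => F (map (nth 0%N u) q)).
Proof.
elim/nat_ind2: K F => [|/=|K IH] F.
- rewrite /= big_seq1 mul1r /gmoment big1 ?mulr1//.
- rewrite big_nil mulr0 big1// => a _.
  rewrite gmoment_cons// big_ord0 mulr0 mulr0//.
rewrite [LHS]/=.
transitivity (\sum_(a < n) \sum_(t < K.+1) v *
   boxsum n K (fun s => F (val a :: insert t a s) * gmoment n s)).
  apply: eq_bigr => a _.
  rewrite -[LHS]/(boxsum n K.+1 (fun s => F (val a :: s) * gmoment n (val a :: s))).
  rewrite (@eq_boxsum _ _ _ _ (fun s => \sum_(t < K.+1) (nth 0%N s t == a)%:R *
     (v * (F (val a :: s) * gmoment n (delete t s))))); last first.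
    move=> s sK sn; rewrite gmoment_cons ?ltn_ord// sK !mulr_sumr.
    by apply: eq_bigr => t _; rewrite mulrCA mulrA mulrCA -!mulrA (mulrCA v).
  rewrite boxsum_sum; apply: eq_bigr => t _.
  rewrite boxsum_insert ?ltn_ord// -1?ltnS// -boxsumMl; apply: eq_boxsum => s sK sn.
  by rewrite delete_insert// sK -ltnS ltn_ord.
under eq_bigr => a _ do under eq_bigr => t _ do rewrite IH.
rewrite pairingsSS [in RHS]big_allpairs_dep -[iota 0 K.+1]/(index_iota 0 K.+1) big_mkord.
rewrite exchange_big mulr_sumr; apply: eq_bigr => t _ /=.
transitivity (v ^+ (K./2).+1 * \sum_(a < n) \sum_(q <- pairings K)
   boxsum n K./2 (fun u => F (val a :: insert t a [seq nth 0%N u i | i <- q]))).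
  by rewrite mulr_sumr; apply: eq_bigr => a _; rewrite exprS mulrA.
congr (_ * _); rewrite exchange_big; apply: eq_bigr => q _.
apply: eq_bigr => a _; apply: eq_boxsum => u _ _.
by rewrite map_insert -map_comp.
Qed.
End Wick.

(** * Averages over refined grids *)

Section Residues.

Definition resid (n : nat) (z : int) : nat := `|(z %% n%:Z)%Z|%N.

Lemma residE n z : (0 < n)%N -> (resid n z)%:Z = (z %% n%:Z)%Z.
Proof. by move=> n0; rewrite /resid gez0_abs// modz_ge0// -lt0n. Qed.

Lemma resid_lt n z : (0 < n)%N -> (resid n z < n)%N.
Proof. by move=> n0; rewrite -ltz_nat residE// ltz_pmod. Qed.

Lemma resid_shift_inj n (e c : int) a b : (0 < n)%N -> e ^+ 2 = 1 ->
  (a < n)%N -> (b < n)%N ->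
  resid n (c + e * a%:Z) = resid n (c + e * b%:Z) -> a = b.
Proof.
move=> n0 e1 an bn /(congr1 Posz); rewrite !residE// => /eqP.
rewrite eqz_mod_dvd => /(dvdz_mull e).
have -> : e * (c + e * a%:Z - (c + e * b%:Z)) = a%:Z - b%:Z.
  transitivity (e ^+ 2 * (a%:Z - b%:Z)); first by ring.
  by rewrite e1 mul1r.
rewrite -eqz_mod_dvd !modz_small ?ltz_nat//; first by move=> /eqP[].
Qed.

(** Translations and reflections permute the residues. *)
Lemma sum_resid_shift (V : nmodType) n (F : nat -> V) (e c : int) :
  e ^+ 2 = 1 ->
  \sum_(a < n) F (resid n (c + e * (val a)%:Z)) = \sum_(r < n) F r.
Proof.
case: n => [|n] e1; first by rewrite !big_ord0.
pose h (a : 'I_n.+1) : 'I_n.+1 := Ordinal (resid_lt (c + e * (val a)%:Z) (ltn0Sn n)).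
rewrite [RHS](reindex_inj (h := h))//=.
move=> a b [] /resid_shift_inj h1.
by apply/val_inj/h1.
Qed.

End Residues.

Section LinearForms.

Definition linform (H : nat) (L : nat -> int) (u : seq nat) : int :=
  \sum_(q < H) L q * (nth 0%N u q)%:Z.

Definition form_size (H : nat) (L : nat -> int) : nat :=
  (\sum_(q < H) `|L q|)%N.

Lemma linform_cons H L a u :
  linform H.+1 L (a :: u) = L 0%N * a%:Z + linform H (L \o succn) u.
Proof. by rewrite /linform big_ord_recl. Qed.

(** The vector m u + v: a point of the grid that is m times finer lies in the
    cell of the point u of the coarse grid. *)
Definition refine (m : nat) (u v : seq nat) : seq nat :=
  [seq (p.1 * m + p.2)%N | p <- zip u v].

Lemma linform_refine H L (m : nat) u v : size u = H -> size v = H ->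
  linform H L (refine m u v) = m%:Z * linform H L u + linform H L v.
Proof.
move=> uH vH; rewrite /linform mulr_sumr -big_split/=.
apply: eq_bigr => q _; rewrite (nth_map (0, 0)%N); last first.
  by rewrite size_zip uH vH minnn ltn_ord.
by rewrite nth_zip ?uH ?vH//= PoszD PoszM; ring.
Qed.

Lemma linform_bound H L (m : nat) v : size v = H -> below m v ->
  (`|linform H L v| <= form_size H L * m)%N.
Proof.
move=> vH /allP vm.
rewrite -lez_nat -[X in X <= _]/(`|linform H L v|) /form_size big_distrl/=.
apply: (le_trans (ler_norm_sum _ _ _)).
rewrite (big_morph Posz PoszD (erefl _)); apply: ler_sum => q _.
rewrite normrM PoszM; apply: ler_wpM2l => //; apply/ltW/vm/mem_nth.
by rewrite vH.
Qed.

Lemma boxsum_refine (V : nmodType) (n m H : nat) (F : seq nat -> V) :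
  boxsum (n * m)%N H F = boxsum n H (fun u => boxsum m H (fun v => F (refine m u v))).
Proof.
elim: H F => [//|H IH] F; rewrite boxsum_recr IH.
rewrite boxsum_recr/=; apply: eq_boxsum => u _ _.
rewrite (eq_bigr (fun a : 'I_n => boxsum m H (fun v => \sum_(b < m)
   F (refine m (val a :: u) (val b :: v))))); last first.
  by move=> a _; rewrite [RHS]boxsum_sum.
rewrite -boxsum_sum; apply: eq_boxsum => v _ _ /=.
rewrite -(big_mkord xpredT (fun a => F (a :: refine m u v))) big_nat_mul/=.
rewrite big_mkord; apply: eq_bigr => a _.
rewrite -{1}(add0n (a * m)%N) big_addn mulSn addnK big_mkord.
by apply: eq_bigr => b _; rewrite /refine/= addnC.
Qed.

(** The positions from which a displacement of at most k steps can wrap around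
    the circle. *)
Definition near0 (n k : nat) (z : int) : bool :=
  (resid n z < k)%N || (n <= resid n z + k)%N.

Lemma sum_near0 n k : (\sum_(r < n) ((r < k) || (n <= r + k)) <= 2 * k)%N.
Proof.
apply: (@leq_trans (\sum_(r < n) ((r < k) + (n <= r + k)))%N).
  by apply: leq_sum => r _; case: (r < k)%N; case: (n <= r + k)%N.
rewrite big_split/= mul2n -addnn; apply: leq_add.
  suff : (\sum_(r < n) (r < k) <= minn n k)%N.
    by move=> /leq_trans->//; exact: geq_minr.
  elim: n => [|n IH]; first by rewrite big_ord0.
  rewrite big_ord_recr/=; move: (\sum_(_ < n) _)%N IH => S.
  by case: (ltnP n k) => nk; rewrite ?addn1 ?addn0; lia.
(* the threshold [N] stays fixed while the induction runs on the range [n] *)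
suff H N : (n <= N)%N -> (\sum_(r < n) (N <= r + k) <= n + k - N)%N.
  by apply: (leq_trans (H n _)) => //; rewrite addKn.
elim: n => [|n IH] nN; first by rewrite big_ord0.
rewrite big_ord_recr/=; move: (\sum_(_ < n) _)%N (IH (ltnW nN)) => S.
by case: (leqP N (n + k)) => nk; rewrite ?addn1 ?addn0; lia.
Qed.

(** For each choice of the other indices the form runs exactly once through all
    residues, because the first index has coefficient one. *)
Lemma boxsum_near0 (T : numDomainType) n k h L : L 0%N = 1 ->
  boxsum n h.+1 (fun u => (near0 n k (linform h.+1 L u))%:R) <=
  (2 * k)%:R * (n ^ h)%N%:R :> T.
Proof.
move=> L1; rewrite boxsum_recr -boxsum_const; apply: ler_boxsum => u _ _.
rewrite -natr_sum ler_nat.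
have [->|n0] := posnP n; first by rewrite big_ord0.
under eq_bigr => a _ do rewrite linform_cons L1 addrC.
rewrite (@sum_resid_shift nat n
  (fun r => nat_of_bool ((r < k) || (n <= r + k))%N)) ?expr1n//.
exact: sum_near0.
Qed.

End LinearForms.

Section Averages.
Variable R : realType.
Local Notation C := R[i].

Definition circpos (n : nat) (z : int) : R := (resid n z)%:R / n%:R.

(** The factors are exchanged one at a time. *)
Lemma ler_norm_prodB (I : Type) (r : seq I) (a b : I -> C) :
  (forall i, `|a i| <= 1) -> (forall i, `|b i| <= 1) ->
  `|\prod_(i <- r) a i - \prod_(i <- r) b i| <= \sum_(i <- r) `|a i - b i|.
Proof.
move=> a1 b1; elim: r => [|i r IH]; first by rewrite !big_nil subrr normr0.
rewrite !big_cons; set A := \prod_(j <- r) a j; set B := \prod_(j <- r) b j.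
have -> : a i * A - b i * B = (a i - b i) * B + a i * (A - B) by ring.
have B1 : `|B| <= 1.
  rewrite /B (big_morph _ (@normrM C) (normr1 _)).
  elim: (r) => [|j r' IHr]; first by rewrite big_nil.
  by rewrite big_cons mulr_ile1 ?normr_ge0 ?prodr_ge0 // => *; exact: normr_ge0.
apply: (le_trans (ler_normD _ _)); apply: lerD; rewrite normrM.
  by rewrite ler_piMr.
by apply: le_trans IH; rewrite ler_piMl.
Qed.

(** Away from 0 no wrapping occurs: m r + w represents the fine position when
    r represents the coarse one, and the positions differ by w / (n m). *)
Lemma circpos_refine (n m k : nat) (z w : int) : (0 < n)%N -> (0 < m)%N ->
  (`|w| <= k * m)%N -> ~~ near0 n k z ->
  `|circpos (n * m)%N (m%:Z * z + w) - circpos n z| <= k%:R / n%:R.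
Proof.
move=> n0 m0 wk; rewrite negb_or -leqNgt -ltnNge => /andP[kr rk].
have nm0 : (0 < n * m)%N by rewrite muln_gt0 n0.
have rE : (resid (n * m)%N (m%:Z * z + w))%:Z = m%:Z * (resid n z)%:Z + w.
  have [q zE] : exists q, z = q * n%:Z + (resid n z)%:Z.
    by exists (z %/ n%:Z)%Z; rewrite residE// -divz_eq.
  rewrite residE//; move: (resid n z) zE kr rk => r -> kr rk.
  have -> : m%:Z * (q * n%:Z + r%:Z) + w =
    q * (n * m)%N%:Z + (m%:Z * r%:Z + w) by rewrite PoszM; ring.
  rewrite modzMDl modz_small// PoszM.
  have : (k * m <= m * r)%N by rewrite mulnC leq_mul2l kr orbT.
  have : (m * r + k * m < n * m)%N.
    by rewrite (mulnC m) -mulnDl ltn_mul2r m0.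
  by move: wk; lia.
have nR : (n%:R != 0 :> R) by rewrite pnatr_eq0 -lt0n.
have mR : (m%:R != 0 :> R) by rewrite pnatr_eq0 -lt0n.
rewrite /circpos -[X in X / _ - _]/((resid (n * m)%N (m%:Z * z + w))%:Z%:~R).
rewrite rE rmorphD rmorphM/= natrM.
have -> : (m%:R * (resid n z)%:R + w%:~R) / (n%:R * m%:R) -
   (resid n z)%:R / n%:R = w%:~R / m%:R / n%:R :> R by field; rewrite nR.
rewrite normrM [X in _ * X]ger0_norm ?invr_ge0//.
apply: ler_wpM2r; first by rewrite invr_ge0.
rewrite normrM [X in _ * X]ger0_norm ?invr_ge0// ler_pdivrMr ?ltr0n//.
by rewrite -natrM -intr_norm -[Num.norm w]abszE ler_nat.
Qed.

(** The first index is the starting point of a walk, and each position of the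
    walk depends on it with coefficient one. *)
Definition shifted (L : nat -> int) : nat -> int :=
  fun q => if q is q'.+1 then L q' else 1.

Variables (lam : R) (g : bool -> R -> C) (h : nat).
Variable fs : seq ((nat -> int) * bool).
Hypothesis lam0 : 0 <= lam.
Hypothesis g1 : forall b x, `|g b x| <= 1.
Hypothesis g_lip : forall b x y, `|g b x - g b y| <= (lam * `|x - y|)%:C.

Definition phase_prod (n : nat) (u : seq nat) : C :=
  \prod_(f <- fs) g f.2 (circpos n (linform h.+1 (shifted f.1) u)).

Definition average (n : nat) : C :=
  (n ^ h.+1)%N%:R^-1 * boxsum n h.+1 (phase_prod n).

Lemma phase_refine b (n m k : nat) (z w : int) : (0 < n)%N -> (0 < m)%N ->
  (`|w| <= k * m)%N ->
  `|g b (circpos (n * m)%N (m%:Z * z + w)) - g b (circpos n z)| <=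
  (lam * (k%:R / n%:R))%:C + 2 * (near0 n k z)%:R.
Proof.
move=> n0 m0 wk; have [_|zk] := boolP (near0 n k z).
  apply: (le_trans (ler_normB _ _)); rewrite mulr1 ler_wpDl//.
    by rewrite lecR mulr_ge0// divr_ge0.
  by rewrite (_ : 2 = 1 + 1)// lerD.
(* away from the jump at 0 the Lipschitz bound applies *)
rewrite mulr0 addr0; apply: (le_trans (g_lip _ _ _)).
by rewrite lecR ler_wpM2l// circpos_refine.
Qed.

Definition total_size := (\sum_(f <- fs) form_size h.+1 (shifted f.1))%N.

(** The box of side n m splits into cells indexed by the box of side n. In a
    cell each phase differs from its value at the corner by O(1/n), unless its
    form is close to 0 on the circle; by [boxsum_near0] the latter happens for a
    proportion O(1/n) of the cells. *)
Lemma average_refine (n m : nat) : (0 < n)%N -> (0 < m)%N ->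
  `|average (n * m)%N - average n| <= ((lam + 4) * total_size%:R / n%:R)%:C.
Proof.
move=> n0 m0.
have n0C : (n%:R != 0 :> C) by rewrite pnatr_eq0 -lt0n.
have m0C : (m%:R != 0 :> C) by rewrite pnatr_eq0 -lt0n.
have -> : average (n * m)%N - average n = ((n * m) ^ h.+1)%N%:R^-1 *
   boxsum n h.+1 (fun u => boxsum m h.+1 (fun v =>
     phase_prod (n * m)%N (refine m u v) - phase_prod n u)).
  rewrite /average boxsum_refine.
  under [in RHS]eq_boxsum => u _ _ do rewrite boxsumB boxsum_const.
  rewrite boxsumB mulrBr; congr (_ - _).
  rewrite (_ : boxsum n h.+1 (fun u => phase_prod n u * _) =
     (m ^ h.+1)%N%:R * boxsum n h.+1 (phase_prod n)).
    rewrite mulrA; congr (_ * _); rewrite expnMn natrM invfM divfK//.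
    by rewrite pnatr_eq0 -lt0n expn_gt0 m0.
  by rewrite -boxsumMl; apply: eq_boxsum => u _ _; rewrite mulrC.
pose k f := form_size h.+1 (shifted f).
rewrite normrM ger0_norm ?invr_ge0 ?ler0n//.
rewrite mulrC ler_pdivrMr ?ltr0n ?expn_gt0 ?muln_gt0 ?n0 ?m0//.
apply: (@le_trans _ _ (boxsum n h.+1 (fun u => boxsum m h.+1 (fun v =>
  \sum_(f <- fs) ((lam * ((k f.1)%:R / n%:R))%:C +
    2 * (near0 n (k f.1) (linform h.+1 (shifted f.1) u))%:R))))).
  apply: (le_trans (ler_norm_boxsum _ _ _)); apply: ler_boxsum => u uh un.
  apply: (le_trans (ler_norm_boxsum _ _ _)); apply: ler_boxsum => v vh vm.
  apply: (le_trans (ler_norm_prodB _ _ _)) => //.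
  apply: ler_sum => f _; rewrite linform_refine//; apply: phase_refine => //.
  exact: linform_bound.
under eq_boxsum => u _ _ do rewrite boxsum_const mulrC.
rewrite boxsumMl boxsum_sum.
have -> : ((lam + 4) * total_size%:R / n%:R)%:C * ((n * m) ^ h.+1)%N%:R =
   (m ^ h.+1)%N%:R * \sum_(f <- fs) ((lam * ((k f.1)%:R / n%:R))%:C * (n ^ h.+1)%N%:R +
     2 * ((2 * k f.1)%:R * (n ^ h)%N%:R)).
  rewrite /total_size natr_sum expnMn [in LHS]natrM mulrA mulrC.
  congr (_ * _); rewrite !(mulr_sumr, mulr_suml) raddf_sum/= mulr_suml.
  apply: eq_bigr => f _; rewrite -/(k _) expnSr !natrM.
  rewrite !(rmorphM, rmorphD)/= !fmorphV/= !rmorph_nat.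
  by field.
apply: ler_wpM2l => //; apply: ler_sum => f _.
rewrite boxsumD boxsum_const boxsumMl lerD2l.
by apply: ler_wpM2l => //; apply: boxsum_near0.
Qed.

End Averages.

(** * Limits of complex sequences *)

Section ComplexLimits.
Variable R : realType.
Local Notation C := R[i].

Lemma norm_complex_i : `|'i%C : C| = 1.
Proof. by rewrite normc_def/= expr0n/= add0r expr1n sqrtr1. Qed.

Lemma norm_complex_le (z : C) : `|z| <= (`|complex.Re z| + `|complex.Im z|)%:C.
Proof.
rewrite {1}(complexE z) rmorphD/=; apply: (le_trans (ler_normD _ _)).
rewrite normrM norm_complex_i mul1r !normc_def/= expr0n/=.
by rewrite !addr0 !sqrtr_sqr.
Qed.

Lemma Re_sub (z w : C) : complex.Re (z - w) = complex.Re z - complex.Re w.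
Proof. by case: z w => ? ? []. Qed.

Lemma Im_sub (z w : C) : complex.Im (z - w) = complex.Im z - complex.Im w.
Proof. by case: z w => ? ? []. Qed.

Lemma normc_ge_Im (z : C) : `|complex.Im z|%:C <= `|z|.
Proof.
have := normc_ge_Re (z * 'i%C).
by rewrite ReiNIm normrN normrM norm_complex_i mulr1.
Qed.

Lemma cvg_complex (a : nat -> C) (x y : R) :
  (fun n => complex.Re (a n)) @ \oo --> x -> (fun n => complex.Im (a n)) @ \oo --> y ->
  a @ \oo --> ((x +i* y : C) : C^o).
Proof.
move=> ax ay; apply/(@cvgrPdist_lt _ C^o) => -[e e'].
rewrite ltcE/= => /andP[/eqP->] e0.
have e20 : 0 < e / 2 by rewrite divr_gt0.
move/cvgrPdist_lt/(_ _ e20): ax; move/cvgrPdist_lt/(_ _ e20): ay.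
apply: filterS2 => n /= yn xn; apply: (le_lt_trans (norm_complex_le _)).
rewrite ltcR [e]splitr; apply: ltrD; first by move: xn; case: (a n).
by move: yn; case: (a n).
Qed.

Lemma bound_cvg0 (B : R) : (B / n.+1%:R) @[n --> \oo] --> 0.
Proof.
rewrite -(mulr0 B); apply: cvgM; first exact: cvg_cst.
exact: cvg_harmonic.
Qed.

Lemma cvg_near_limit (a b : nat -> C) (l : C) (B : R) :
  (forall n, `|a n - b n| <= (B / n.+1%:R)%:C) ->
  b @ \oo --> (l : C^o) -> a @ \oo --> (l : C^o).
Proof.
move=> ab /(@cvgrPdist_lt _ C^o) bl; apply/(@cvgrPdist_lt _ C^o) => -[e e'].
rewrite ltcE/= => /andP[/eqP->] e0.
have e20 : 0 < e / 2 by rewrite divr_gt0.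
have e20C : 0 < (e / 2)%:C by rewrite ltcR.
have /cvgrPdist_lt/(_ _ e20) := bound_cvg0 B; move/(_ _ e20C): bl.
apply: filterS2 => n /= ln; rewrite sub0r normrN => nB.
rewrite (_ : l - a n = (l - b n) - (a n - b n)); last by rewrite opprB addrA subrK.
apply: (le_lt_trans (ler_normB _ _)).
rewrite -[ltRHS]/(e%:C) [e]splitr rmorphD/=; apply: ltrD => //.
apply: (le_lt_trans (ab n)); rewrite ltcR; apply: le_lt_trans nB.
exact: ler_norm.
Qed.

Lemma almost_constant_cvg (x : nat -> R) (B : R) :
  (forall n m, `|x n - x m| <= B / n.+1%:R + B / m.+1%:R) ->
  exists l : R, x @ \oo --> l.
Proof.
move=> xB; suff : cvg (x @ \oo) by exists (lim (x @ \oo)).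
apply: cauchy_cvg; apply: cauchy_exP => e e0.
have e20 : 0 < e / 2 by rewrite divr_gt0.
have /cvgrPdist_lt/(_ _ e20) [N _ NB] := bound_cvg0 B.
exists (x N); exists N => // n /= Nn; rewrite /ball/= (splitr e).
have bnd k : (N <= k)%N -> B / k.+1%:R < e / 2.
  move=> /NB/=; rewrite sub0r normrN; apply: le_lt_trans; exact: ler_norm.
by apply: (le_lt_trans (xB _ _)); apply: ltrD; apply: bnd.
Qed.

(** Indices n and m are compared through their common multiple n m, which
    gives the Cauchy property. *)
Lemma refine_cvg (a : nat -> C) (B : R) :
  (forall n m, (0 < n)%N -> (0 < m)%N -> `|a (n * m)%N - a n| <= (B / n%:R)%:C) ->
  exists l : C, (fun n => a n.+1) @ \oo --> (l : C^o).
Proof.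
move=> aB.
have aBB n m : `|a n.+1 - a m.+1| <= (B / n.+1%:R + B / m.+1%:R)%:C.
  rewrite rmorphD/= -[a n.+1](subrK (a (n.+1 * m.+1)%N)) -addrA.
  apply: (le_trans (ler_normD _ _)); apply: lerD; first by rewrite distrC aB.
  by rewrite mulnC aB.
have [x ax] : exists x : R, (fun n => complex.Re (a n.+1)) @ \oo --> x.
  apply: (@almost_constant_cvg (fun n => complex.Re (a n.+1)) B) => n m; rewrite -lecR.
  apply: le_trans (aBB n m); rewrite -Re_sub; exact: normc_ge_Re.
have [y ay] : exists y : R, (fun n => complex.Im (a n.+1)) @ \oo --> y.
  apply: (@almost_constant_cvg (fun n => complex.Im (a n.+1)) B) => n m; rewrite -lecR.
  apply: le_trans (aBB n m); rewrite -Im_sub; exact: normc_ge_Im.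
by exists (x +i* y); exact: (@cvg_complex (fun n => a n.+1)).
Qed.

End ComplexLimits.

(** * Densities and independence *)

Section Density.
Context d d' (T : measurableType d) (U : measurableType d') (R : realType).
Variables (m : {measure set T -> \bar R}) (nu : {measure set U -> \bar R}).
Variables (X : T -> U) (w : T -> R).
Hypothesis mX : measurable_fun setT X.
Hypothesis mw : measurable_fun setT w.
Hypothesis w0 : forall t, 0 <= w t.
Hypothesis nuE : forall B, measurable B ->
  (\int[m]_t (\1_B (X t) * w t)%:E = nu B)%E.

Import HBNNSimple.

Let mwE : measurable_fun setT (fun t => (w t)%:E).
Proof. exact/measurable_EFinP. Qed.

Let mindicX B : measurable B -> measurable_fun setT (fun t => \1_B (X t) : R).
Proof. by move=> mB; apply: measurableT_comp mX; exact: measurable_indic. Qed.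

Let density_nnsfun (h : {nnsfun U >-> R}) :
  (\int[m]_t ((h (X t))%:E * (w t)%:E) = \int[nu]_u (h u)%:E)%E.
Proof.
under [RHS]eq_integral do rewrite fimfunE -fsumEFin//.
rewrite [RHS]ge0_integral_fsum//; last 2 first.
  - by move=> r; exact/measurable_EFinP/measurable_funM.
  - by move=> n x _; rewrite EFinM nnfun_muleindic_ge0.
under [LHS]eq_integral.
  move=> t _; rewrite fimfunE -fsumEFin// ge0_mule_fsuml; last first.
    by move=> r; rewrite EFinM nnfun_muleindic_ge0.
  over.
have mind r : measurable_fun setT (fun t => (r * \1_(h @^-1` [set r]) (X t))%:E).
  apply/measurable_EFinP/measurable_funM => //.
  exact: mindicX.
rewrite [LHS]ge0_integral_fsum//; last 2 first.
  - by move=> r; exact: emeasurable_funM.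
  - by move=> r t _; rewrite mule_ge0// ?lee_fin// -lee_fin EFinM nnfun_muleindic_ge0.
apply: eq_fsbigr => r _; rewrite integralZl_indic_nnsfun// integral_indic//.
rewrite setIT -nuE//.
have [r0|r0] := ltP r 0.
  rewrite preimage_nnfun0// indic0.
  by rewrite !integral0_eq ?mule0// => t _; rewrite ?mulr0 ?mul0r ?mul0e.
rewrite -ge0_integralZl//; last 2 first.
  - apply/measurable_EFinP/measurable_funM => //.
    exact: mindicX.
  - by move=> t _; rewrite lee_fin mulr_ge0.
by apply: eq_integral => t _; rewrite -!EFinM mulrA.
Qed.

(** Testing [nu] on sets determines its integrals, through simple functions and
    monotone limits. The case [w] = 1 transports an integral to the law of [X];
    the case where [X] is the identity is the integral against a density; for
    independent variables, [w] is the product of the other factors. *)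
Lemma ge0_integral_density (g : U -> \bar R) :
  measurable_fun setT g -> (forall u, 0 <= g u)%E ->
  (\int[m]_t (g (X t) * (w t)%:E) = \int[nu]_u g u)%E.
Proof.
move=> mg g0; pose h := nnsfun_approx measurableT mg.
transitivity (lim (\int[m]_t ((h n (X t))%:E * (w t)%:E) @[n --> \oo])%E).
  rewrite -monotone_convergence//=.
  - apply: eq_integral => t _; apply/esym/cvg_lim => //=.
    by apply: cvgeZr => //; exact: cvg_nnsfun_approx.
  - move=> n; apply: emeasurable_funM => //.
    by apply/measurable_EFinP; exact: measurableT_comp.
  - by move=> n t _; rewrite mule_ge0// lee_fin.
  - move=> t _ a b ab; rewrite lee_wpmul2r ?lee_fin//.
    exact/lefP/nd_nnsfun_approx.
transitivity (lim (\int[nu]_u (h n u)%:E @[n --> \oo])%E).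
  by under eq_fun do rewrite density_nnsfun.
rewrite -monotone_convergence//=.
- by apply: eq_integral => u _; apply/cvg_lim => //=; exact: cvg_nnsfun_approx.
- by move=> n; exact/measurable_EFinP.
- by move=> n u _; rewrite lee_fin.
- by move=> u _ a b ab; rewrite lee_fin; exact/lefP/nd_nnsfun_approx.
Qed.

Lemma integrable_density (g : U -> R) : measurable_fun setT g ->
  nu.-integrable setT (EFin \o g) ->
  m.-integrable setT (fun t => (g (X t) * w t)%:E).
Proof.
move=> mg /integrableP[_ ig]; apply/integrableP; split.
  by apply/measurable_EFinP/measurable_funM => //; exact: measurableT_comp.
move: ig; rewrite -(@ge0_integral_density (fun u => `|(g u)%:E|%E))//; last first.
  by apply: measurableT_comp => //; exact/measurable_EFinP.
apply: le_lt_trans; rewrite le_eqVlt; apply/orP; left; apply/eqP/eq_integral => t _.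
by rewrite EFinM abseM [X in (_ * X)%E]gee0_abs// lee_fin.
Qed.

Lemma integral_density (g : U -> R) : measurable_fun setT g ->
  (\int[m]_t (g (X t) * w t)%:E = \int[nu]_u (g u)%:E)%E.
Proof.
move=> mg; have mgE : measurable_fun setT (EFin \o g) by exact/measurable_EFinP.
rewrite [LHS]integralE [RHS]integralE; congr (_ - _)%E.
- rewrite -ge0_integral_density//; last exact: measurable_funepos.
  apply: eq_integral => t _; rewrite !funeposE -!EFin_max -EFinM.
  by rewrite maxr_pMl// mul0r.
- rewrite -ge0_integral_density//; last exact: measurable_funeneg.
  apply: eq_integral => t _; rewrite !funenegE -!EFinN -!EFin_max -EFinM.
  by rewrite maxr_pMl// mul0r mulNr.
Qed.

End Density.

Section Independence.
Context d (T : measurableType d) (R : realType) (P : probability T R).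
Variables (X : nat -> T -> R) (J : seq nat).
Hypothesis mX : forall j, measurable_fun setT (X j).
Hypothesis uJ : uniq J.
Hypothesis indepX : forall B : nat -> set R, (forall j, measurable (B j)) ->
  P (\bigcap_(j in [set` J]) (X j @^-1` B j)) =
  (\prod_(j <- J) P (X j @^-1` B j))%E.

Local Notation Ex := (Rintegral P setT).

Let mXB j B : measurable B -> measurable (X j @^-1` B).
Proof. by move=> mB; rewrite -[_ @^-1` _]setTI; exact: mX. Qed.

Let indicX j (B : set R) : (fun t => \1_B (X j t) : R) = \1_(X j @^-1` B).
Proof. by apply/funext => t; rewrite !indicE. Qed.

Let Eindic j (B : set R) : measurable B ->
  Ex (fun t => \1_B (X j t) : R) = fine (P (X j @^-1` B)).
Proof.
by move=> mB; rewrite indicX /Rintegral integral_indic ?setIT//; exact: mXB.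
Qed.

Let indep_indic (B : nat -> set R) : (forall j, measurable (B j)) ->
  (\int[P]_t (\prod_(j <- J) \1_(B j) (X j t))%:E =
   (\prod_(j <- J) Ex (fun t => \1_(B j) (X j t) : R))%:E)%E.
Proof.
move=> mB; transitivity (P (\bigcap_(j in [set` J]) (X j @^-1` B j))).
  rewrite -[in RHS](setIT (\bigcap_(_ in _) _)) -integral_indic//; last first.
    by apply: fin_bigcap_measurable => // j _; exact: mXB.
  apply: eq_integral => t _; congr EFin; rewrite indicE.
  have [Bt|] := boolP (t \in _).
    rewrite big_seq big1// => j jJ; rewrite indicE mem_set//.
    by move: Bt; rewrite inE => /(_ j jJ).
  rewrite notin_setE/= => Bt; apply/eqP.
  rewrite prodf_seq_eq0; apply/hasP; apply: contrapT => h; apply: Bt => j jJ.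
  apply: contrapT => BjX; apply: h; exists j => //=.
  by rewrite indicE memNset.
rewrite indepX// (eq_bigr (fun j => (fine (P (X j @^-1` B j)))%:E)); last first.
  by move=> j _; rewrite fineK// fin_num_measure//; exact: mXB.
rewrite -(big_morph EFin EFinM (erefl _)); congr EFin.
by apply: eq_bigr => j _; rewrite Eindic.
Qed.

Let mXg (g : R -> R) j : measurable_fun setT g ->
  measurable_fun setT (fun t => g (X j t)).
Proof. by move=> mg; exact: measurableT_comp. Qed.

Let mprod (r : seq nat) (h : nat -> R -> R) :
  (forall j, measurable_fun setT (h j)) ->
  measurable_fun setT (fun t => \prod_(j <- r) h j (X j t)).
Proof. by move=> mh; apply: measurable_prod => j _; exact: mXg. Qed.

Let ige0 (f : T -> R) : (forall t, 0 <= f t) ->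
  P.-integrable setT (EFin \o f) -> (\int[P]_t (f t)%:E = (Ex f)%:E)%E.
Proof. by move=> f0 fi; rewrite /Rintegral fineK//; exact: integrable_fin_num. Qed.

(** Indicators are replaced by the functions [g j] one coordinate at a time.
    When the turn of [k] comes, let [w] be the product of the other factors and
    [c] the product of their expectations. By the induction hypothesis, [X k] has
    under the measure with density [w] the law [c] times its law under [P], and
    integrating [g k] against it gives the claim. *)
Let ge0_indep_prod (g : nat -> R -> R) :
  (forall j, measurable_fun setT (g j)) -> (forall j x, 0 <= g j x) ->
  (forall j, P.-integrable setT (fun t => (g j (X j t))%:E)) ->
  (\int[P]_t (\prod_(j <- J) g j (X j t))%:E =
   (\prod_(j <- J) Ex (fun t => g j (X j t)))%:E)%E.
Proof.
move=> mg g0 ig.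
pose u (K : seq nat) (B : nat -> set R) j : R -> R :=
  if j \in K then g j else \1_(B j).
suff H K B : (forall j, measurable (B j)) ->
    (\int[P]_t (\prod_(j <- J) u K B j (X j t))%:E =
     (\prod_(j <- J) Ex (fun t => u K B j (X j t)))%:E)%E.
  have := H J (fun=> setT) (fun=> measurableT).
  rewrite (eq_big_seq (fun j => Ex (fun t => g j (X j t)))); last first.
    by move=> j jJ; rewrite /u jJ.
  move=> <-; apply: eq_integral => t _; congr EFin.
  by apply: eq_big_seq => j jJ; rewrite /u jJ.
have mu K' B' j : (forall j, measurable (B' j)) -> measurable_fun setT (u K' B' j).
  by rewrite /u => mB; case: ifP => // _; exact: measurable_indic.
have u0 K' B' j x : 0 <= u K' B' j x by rewrite /u; case: ifP.
elim: K B => [|k K IH] B mB; first exact: indep_indic.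
have [kK|kNK] := boolP (k \in K).
  have -> : u (k :: K) B = u K B.
    by apply/funext => j; rewrite /u inE; case: eqP => // ->; rewrite kK.
  exact: IH.
have [kJ|kNJ] := boolP (k \in J); last first.
  rewrite (eq_big_seq (fun j => Ex (fun t => u K B j (X j t)))); last first.
    by move=> j jJ; rewrite /u inE; case: eqP => // jk; rewrite -jk jJ in kNJ.
  rewrite -IH//; apply: eq_integral => t _; congr EFin.
  apply: eq_big_seq => j jJ; rewrite /u inE; case: eqP => // jk.
  by rewrite -jk jJ in kNJ.
pose w t := \prod_(j <- rem k J) u K B j (X j t).
have w0 t : 0 <= w t by apply: prodr_ge0.
have mw : measurable_fun setT w by apply: mprod => j; exact: mu.
pose c := \prod_(j <- rem k J) Ex (fun t => u K B j (X j t)).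
have c0 : 0 <= c by apply: prodr_ge0 => j _; apply: Rintegral_ge0.
have uk C j : j \in rem k J ->
    u K (fun i => if i == k then C else B i) j = u K B j.
  by rewrite mem_rem_uniq// inE => /andP[/negbTE jk _]; rewrite /u jk.
have uk' j : j \in rem k J -> u (k :: K) B j = u K B j.
  by rewrite mem_rem_uniq// inE => /andP[/negbTE jk _]; rewrite /u inE jk.
have ukk C : u K (fun i => if i == k then C else B i) k = \1_C.
  by rewrite /u (negbTE kNK) eqxx.
have uk'k : u (k :: K) B k = g k by rewrite /u mem_head.
pose Xk : {RV P >-> R} := mfun_Sub (mem_set (mX k) : X k \in mfun).
have dens C : measurable C ->
    (\int[P]_t (\1_C (X k t) * w t)%:E = mscale (NngNum c0) (distribution P Xk) C)%E.
  move=> mC.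
  have mB' i : measurable (if i == k then C else B i) by case: ifP.
  have := IH _ mB'; rewrite [in RHS](big_rem k)//= ukk.
  under [in RHS]eq_big_seq => j jk do rewrite uk//.
  rewrite Eindic// -/c => e; rewrite /mscale/= /distribution/= /pushforward.
  transitivity (fine (P (X k @^-1` C)) * c)%:E.
    rewrite -e; apply: eq_integral => t _; congr EFin.
    rewrite (big_rem k kJ)/= ukk; congr (_ * _).
    by apply: eq_big_seq => j jk; rewrite uk.
  by rewrite EFinM fineK ?fin_num_measure//; [rewrite muleC|exact: mXB].
rewrite [in RHS](big_rem k)//= uk'k; under [in RHS]eq_big_seq => j jk do rewrite uk'//.
rewrite -/c.
transitivity (\int[P]_t (g k (X k t) * w t)%:E)%E.
  apply: eq_integral => t _; congr EFin.
  rewrite (big_rem k kJ)/= uk'k; congr (_ * _).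
  by apply: eq_big_seq => j jk; rewrite uk'.
rewrite (integral_density (mX k) mw w0 dens)//.
rewrite ge0_integral_mscale//; last 2 first.
  - exact/measurable_EFinP.
  - by move=> x _; rewrite lee_fin.
rewrite ge0_integral_distribution//; last 2 first.
  - exact/measurable_EFinP.
  - by move=> x; rewrite lee_fin.
by rewrite EFinM muleC -ige0//; exact: ig.
Qed.

Lemma integrable_indep_prod (g : nat -> R -> R) :
  (forall j, measurable_fun setT (g j)) ->
  (forall j, P.-integrable setT (fun t => (g j (X j t))%:E)) ->
  P.-integrable setT (fun t => (\prod_(j <- J) g j (X j t))%:E).
Proof.
move=> mg ig; apply/integrableP; split; first exact/measurable_EFinP/mprod.
under eq_integral => t _ do
  rewrite abse_EFin (big_morph _ (@normrM R) (normr1 _)).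
rewrite (ge0_indep_prod (g := fun j x => `|g j x|)) ?ltry//.
- by move=> j; exact: measurableT_comp.
- by move=> j; have /integrable_norm := ig j.
Qed.

(** Both sides are linear in each factor, so the factors can be split into
    positive and negative parts one coordinate at a time. *)
Theorem expectation_indep_prod (g : nat -> R -> R) :
  (forall j, measurable_fun setT (g j)) ->
  (forall j, P.-integrable setT (fun t => (g j (X j t))%:E)) ->
  Ex (fun t => \prod_(j <- J) g j (X j t)) =
  \prod_(j <- J) Ex (fun t => g j (X j t)).
Proof.
suff H (K : seq nat) (h : nat -> R -> R) :
    (forall j, measurable_fun setT (h j)) ->
    (forall j, P.-integrable setT (fun t => (h j (X j t))%:E)) ->
    (forall j, j \notin K -> forall x, 0 <= h j x) ->
    Ex (fun t => \prod_(j <- J) h j (X j t)) =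
    \prod_(j <- J) Ex (fun t => h j (X j t)).
  (* the functions outside [J] are replaced by 0 to start with nonnegative ones *)
  move=> mg ig; pose h (j : nat) : R -> R := if j \in J then g j else cst 0.
  have hg j : j \in J -> h j = g j by rewrite /h => ->.
  have := H J h; under [in LHS]eq_Rintegral => t _.
    by under eq_big_seq => j jJ do rewrite hg//; over.
  under [in RHS]eq_big_seq => j jJ do rewrite hg//.
  apply.
  - by move=> j; rewrite /h; case: ifP.
  - by move=> j; rewrite /h; case: ifP => // _; exact: integrable0.
  - by move=> j /negbTE jJ x; rewrite /h jJ.
elim: K h => [|k K IH] h mh ih h0.
  by rewrite {1}/Rintegral ge0_indep_prod// => j x; exact: h0.
have [kJ|kNJ] := boolP (k \in J); last first.
  pose h' j := if j == k then cst 0 else h j.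
  have hh' j : j \in J -> h j = h' j.
    by rewrite /h'; case: eqP => // -> kJ; rewrite kJ in kNJ.
  under eq_Rintegral => t _.
    by under eq_big_seq => j jJ do rewrite hh'//; over.
  under [in RHS]eq_big_seq => j jJ do rewrite hh'//.
  apply: IH.
  - by move=> j; rewrite /h'; case: ifP.
  - by move=> j; rewrite /h'; case: ifP => // _; exact: integrable0.
  - move=> j jK x; rewrite /h'; case: eqP => // /eqP jk; apply: h0.
    by rewrite inE negb_or jk.
pose upd (f : R -> R) j := if j == k then f else h j.
have updk f : upd f k = f by rewrite /upd eqxx.
have updr f j : j \in rem k J -> upd f j = h j.
  by rewrite mem_rem_uniq// inE => /andP[/negbTE jk _]; rewrite /upd jk.
have mp : measurable_fun setT (h k)^\+ by exact: measurable_funrpos.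
have mn : measurable_fun setT (h k)^\- by exact: measurable_funrneg.
have ip : P.-integrable setT (fun t => ((h k)^\+ (X k t))%:E).
  exact: (integrable_funrpos measurableT (ih k)).
have inn : P.-integrable setT (fun t => ((h k)^\- (X k t))%:E).
  exact: (integrable_funrneg measurableT (ih k)).
have IHupd (f : R -> R) : measurable_fun setT f -> (forall x, 0 <= f x) ->
    P.-integrable setT (fun t => (f (X k t))%:E) ->
    P.-integrable setT (fun t => (\prod_(j <- J) upd f j (X j t))%:E) /\
    Ex (fun t => \prod_(j <- J) upd f j (X j t)) =
    Ex (fun t => f (X k t)) * \prod_(j <- rem k J) Ex (fun t => h j (X j t)).
  move=> mf f0 jf.
  have mu j : measurable_fun setT (upd f j) by rewrite /upd; case: ifP.
  have ju j : P.-integrable setT (fun t => (upd f j (X j t))%:E).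
    by rewrite /upd; case: eqP => // ->.
  split; first exact: integrable_indep_prod.
  rewrite IH//.
    rewrite (big_rem k)//= updk; congr (_ * _).
    by apply: eq_big_seq => j jk; rewrite updr.
  move=> j jK x; rewrite /upd; case: eqP => // /eqP jk; apply: h0.
  by rewrite inE negb_or jk.
have [jp ep] := IHupd _ mp (funrpos_ge0 _) ip.
have [jn en] := IHupd _ mn (funrneg_ge0 _) inn.
rewrite [RHS](big_rem k)//=.
have -> : Ex (fun t => h k (X k t)) =
    Ex (fun t => (h k)^\+ (X k t)) - Ex (fun t => (h k)^\- (X k t)).
  rewrite -RintegralB//; apply: eq_Rintegral => t _.
  by rewrite -[h k in LHS]funrposBneg.
rewrite mulrBl -ep -en -RintegralB//; apply: eq_Rintegral => t _.
rewrite !(big_rem k kJ)/= !updk.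
under [X in _ = _ * X - _]eq_big_seq => j jk do rewrite updr//.
under [X in _ = _ - _ * X]eq_big_seq => j jk do rewrite updr//.
by rewrite -mulrBl -[h k in LHS]funrposBneg.
Qed.

End Independence.

(** * Moments of a Gaussian variable *)

Section VanishingIntegral.
Context {R : realType}.
Local Notation mu := (@lebesgue_measure R).

(** The integral of [f] from - a to a is F(a) - F(- a), of size at most 2 C / a,
    and it tends to the integral over the line. *)
Lemma integral_derivative_eq0 (F f : R -> R) (C : R) :
  (forall x : R, is_derive x 1 F (f x)) -> continuous f ->
  mu.-integrable setT (EFin \o f) ->
  (forall x, `|x * F x| <= C) ->
  (\int[mu]_x (f x)%:E = 0)%E.
Proof.
move=> dF cf fi FC.
have mf : measurable_fun setT f.
  by have := measurable_int _ fi => /measurable_EFinP.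
pose itv n : set R := `[- n.+1%:R, n.+1%:R]%classic.
have lim1 : (\int[mu]_(x in itv n) (f x)%:E @[n --> \oo] --> \int[mu]_x (f x)%:E)%E.
  under eq_cvg => n do rewrite integral_mkcond.
  have [//|||||//] := @dominated_convergence _ _ _ mu setT measurableT
     (fun n => (EFin \o f) \_ (itv n)) (EFin \o f) (abse \o (EFin \o f)).
  - move=> n; apply/(measurable_restrictT _ _).1 => //; first exact: measurable_itv.
    by apply: measurable_funTS; exact/measurable_EFinP.
  - exact/measurable_EFinP.
  - apply: aeW => x _; apply: cvg_near_cst.
    exists (Num.truncn `|x|) => // n /= xn; rewrite patchE mem_set//.
    rewrite /itv/= in_itv/= -ler_norml; apply: ltW.
    by rewrite (lt_le_trans (truncnS_gt _))// ler_nat ltnS.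
  - exact: integrable_abse.
  - by apply: aeW => x n _; rewrite patchE; case: ifP => //= _; rewrite normr0 lee_fin.
have lim2 : (\int[mu]_(x in itv n) (f x)%:E @[n --> \oo] --> 0%:E)%E.
  have -> : (fun n => \int[mu]_(x in itv n) (f x)%:E)%E =
      (fun n => (F n.+1%:R - F (- n.+1%:R))%:E).
    apply/funext => n; rewrite (@continuous_FTC2 _ f F)//.
    - by rewrite gtrN.
    - exact: continuous_subspaceT.
    - have cF : continuous F.
        move=> x; apply: differentiable_continuous; apply/derivable1_diffP.
        exact: ex_derive.
      split; first by move=> x _; exact: ex_derive.
        exact/cvg_at_right_filter/cF.
      exact/cvg_at_left_filter/cF.
    - by move=> x _; rewrite derive1E; exact: derive_val.
  apply/cvg_EFin; first exact: nearW.
  apply/cvgrPdist_lt => e e0.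
  have /cvgrPdist_lt/(_ _ e0) := bound_cvg0 (2 * C).
  apply: filterS => n /=; rewrite !sub0r !normrN; apply: le_lt_trans.
  apply: (le_trans _ (ler_norm _)).
  rewrite ler_pdivlMr ?ltr0n// -[X in _ * X <= _]ger0_norm// -normrM.
  rewrite mulrBl; apply: (le_trans (ler_normB _ _)).
  rewrite mulr2n mulrDl !mul1r; apply: lerD; first by rewrite mulrC; exact: FC.
  by rewrite -normrN -mulrN mulrC; exact: FC.
exact: (cvg_unique _ lim1 lim2).
Qed.

End VanishingIntegral.

Section GaussianMoments.
Variables (R : realType) (s : R).
Hypothesis s0 : 0 < s.
Local Notation mu := (@lebesgue_measure R).
Local Notation pdf := (normal_pdf 0 s).

Let sn0 : s != 0. Proof. exact: lt0r_neq0. Qed.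

Let s' := Num.sqrt 2 * s.
Let s'0 : s' != 0.
Proof. by rewrite mulf_neq0// sqrtr_eq0 -ltNge. Qed.

(** With y = x^2 / (4 s^2) the density is a multiple of exp(- 2 y), one factor
    exp(- y) of which absorbs the power of x. The other one is the density with
    variance 2 s^2, up to a constant. *)
Lemma normal_pdf_decay (k : nat) : exists2 C, 0 <= C &
  forall x, `|x| ^+ k * pdf x <= C * normal_pdf 0 s' x.
Proof.
pose c := s ^+ 2 *+ 4.
have c0 : 0 < c by rewrite pmulrn_lgt0// exprn_gt0.
pose C := normal_peak s * (1 + c ^+ k * k`!%:R) / normal_peak s'.
have pk0 : 0 < normal_peak s by exact: normal_peak_gt0.
have pk0' : 0 < normal_peak s' by exact: normal_peak_gt0.
exists C.
  by rewrite divr_ge0 ?ltW// mulr_gt0// addr_gt0// mulr_gt0 ?exprn_gt0// ltr0n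
    fact_gt0.
move=> x; rewrite (normal_pdfE 0 sn0) (normal_pdfE 0 s'0) /C.
move: (normal_peak s) (normal_peak s') pk0 pk0' => p p' p0 p'0.
rewrite mulrCA [leRHS]mulrA divfK ?lt0r_neq0// -[leRHS]mulrA.
apply: ler_wpM2l; first exact: ltW.
rewrite /normal_fun !subr0.
pose y := x ^+ 2 / c.
have y0 : 0 <= y by rewrite divr_ge0 ?sqr_ge0// ltW.
have -> : - x ^+ 2 / (s ^+ 2 *+ 2) = - y - y.
  by rewrite /y /c; field.
have -> : - x ^+ 2 / (s' ^+ 2 *+ 2) = - y.
  by rewrite /y /c /s' exprMn sqr_sqrtr//; field.
rewrite expRD mulrA; apply: ler_wpM2r; first exact: expR_ge0.
have xk : `|x| ^+ k <= 1 + (x ^+ 2) ^+ k.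
  have [x1|x1] := leP `|x| 1.
    by rewrite (le_trans (exprn_ile1 _ _ x1))// lerDl exprn_ge0// sqr_ge0.
  apply: ler_wpDl => //; rewrite -real_normK ?num_real// -exprM.
  by rewrite ler_weXn2l ?ltW// leq_pmull.
have yk : y ^+ k <= k`!%:R * expR y.
  case: (k) => [|n]; first by rewrite expr0 fact0 mul1r -[leLHS]expR0 ler_expR.
  have f0 : 0 < (n.+1)`!%:R :> R by rewrite ltr0n fact_gt0.
  rewrite mulrC -ler_pdivrMr//; apply: le_trans (expR_ge1Dxn n y0).
  exact: ler_wpDl.
have e1 : expR (- y) <= 1 by rewrite -expR0 ler_expR oppr_le0.
apply: (le_trans (ler_wpM2r (expR_ge0 _) xk)).
rewrite mulrDl mul1r; apply: lerD => //.
have -> : x ^+ 2 = c * y by rewrite /y mulrC divfK// lt0r_neq0.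
rewrite exprMn -mulrA; apply: ler_wpM2l; first by rewrite exprn_ge0// ltW.
apply: (le_trans (ler_wpM2r (expR_ge0 _) yk)).
by rewrite -mulrA -expRD subrr expR0 mulr1.
Qed.

Lemma integrable_pow_pdf k :
  mu.-integrable setT (fun x => (x ^+ k * pdf x)%:E).
Proof.
have [C C0 Cb] := normal_pdf_decay k.
have ig : mu.-integrable setT (fun x => (C * normal_pdf 0 s' x)%:E).
  under eq_fun do rewrite EFinM.
  by apply: integrableZl => //; exact: integrable_normal_pdf.
apply: le_integrable ig => //.
- apply/measurable_EFinP/measurable_funM; last exact: measurable_normal_pdf.
  exact: exprn_measurable.
- move=> x _; rewrite lee_fin normrM normrX [X in _ * X]ger0_norm ?normal_pdf_ge0//.
  by rewrite [leRHS]ger0_norm ?mulr_ge0 ?normal_pdf_ge0//; exact: Cb.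
Qed.

Lemma is_derive_normal_pdf (x : R) :
  is_derive x 1 pdf (- (x / s ^+ 2) * pdf x).
Proof.
pose k := - (s ^+ 2 *+ 2)^-1.
have -> : normal_pdf 0 s = normal_peak s \*: (expR \o (k \*: (@id R ^+ 2))).
  apply/funext => y; rewrite (normal_pdfE 0 sn0) /normal_fun/= subr0.
  by congr (_ * expR _); rewrite mulNr -mulrN mulrC.
apply: is_derive_eq => /=.
move: (normal_peak s) (expR _) => p e.
by rewrite /k /GRing.scale/=; field.
Qed.

(** The difference of the two integrands is the derivative of x^j times the
    density. *)
Lemma integral_pow_pdfS (j : nat) :
  (\int[mu]_x (j%:R * x ^+ j.-1 * pdf x)%:E =
   (s ^- 2)%:E * \int[mu]_x (x ^+ j.+1 * pdf x)%:E)%E.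
Proof.
pose f x := j%:R * x ^+ j.-1 * pdf x - s ^- 2 * (x ^+ j.+1 * pdf x).
have ij : mu.-integrable setT (fun x => (j%:R * x ^+ j.-1 * pdf x)%:E).
  under eq_fun do rewrite -mulrA EFinM.
  by apply: integrableZl => //; exact: integrable_pow_pdf.
have ij1 : mu.-integrable setT (fun x => (s ^- 2 * (x ^+ j.+1 * pdf x))%:E).
  under eq_fun do rewrite EFinM.
  by apply: integrableZl => //; exact: integrable_pow_pdf.
have cpdf : continuous pdf by exact: continuous_normal_pdf.
have [C C0 Cb] := normal_pdf_decay j.+1.
have : (\int[mu]_x (f x)%:E = 0)%E.
  apply: (@integral_derivative_eq0 _ (fun x => x ^+ j * pdf x) _
    (C * normal_peak s')).
  - move=> x; have -> : (fun x => x ^+ j * pdf x) = (@id R ^+ j) * pdf.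
      by apply/funext => y; rewrite /= fctE exprfctE.
    have dpdf := is_derive_normal_pdf x.
    apply: is_derive_eq; rewrite exprfctE/= /f /GRing.scale/= (exprS x j).
    by move: (pdf x) => p; field.
  - move=> x; apply: cvgB; apply: cvgM.
    + by apply: cvgM; [exact: cvg_cst|exact: exprn_continuous].
    + exact: cpdf.
    + exact: cvg_cst.
    + by apply: cvgM; [exact: exprn_continuous|exact: cpdf].
  - exact: (integrableB measurableT ij ij1).
  - move=> x; rewrite mulrA -exprS normrM normrX [X in _ * X]ger0_norm ?normal_pdf_ge0//.
    apply: (le_trans (Cb x)); apply: ler_wpM2l => //; exact: normal_pdf_ub.
under eq_integral do rewrite EFinB.
rewrite (integralB measurableT ij ij1).
under [in X in (_ - X)%E]eq_integral do rewrite EFinM.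
rewrite integralZl//; last exact: integrable_pow_pdf.
move=> /eqP; rewrite sube_eq ?add0e//; first by move/eqP.
exact: integrable_fin_num.
Qed.

Definition gaussian_moment k : R :=
  \int[@normal_prob R 0 s]_(x in setT) (x ^+ k).

Let pdf_density B : measurable B ->
  (\int[mu]_x (\1_B x * pdf x)%:E = @normal_prob R 0 s B)%E.
Proof.
move=> mB; rewrite /normal_prob [RHS]integral_mkcond.
apply: eq_integral => x _; rewrite patchE indicE.
by case: ifP => _; rewrite ?mul1r ?mul0r.
Qed.

Let pdf_integral (g : R -> R) : measurable_fun setT g ->
  (\int[mu]_x (g x * pdf x)%:E = \int[@normal_prob R 0 s]_x (g x)%:E)%E.
Proof.
have H := @integral_density _ _ _ _ _ mu (@normal_prob R 0 s) id pdf.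
by move=> mg; apply: H => // [|x]; [exact: measurable_normal_pdf|exact: normal_pdf_ge0].
Qed.

Lemma gaussian_momentE k : ((gaussian_moment k)%:E =
  \int[mu]_x (x ^+ k * pdf x)%:E)%E.
Proof.
rewrite /gaussian_moment /Rintegral -pdf_integral ?fineK//.
  by apply: integrable_fin_num => //; exact: integrable_pow_pdf.
Qed.

Lemma gaussian_moment0 : gaussian_moment 0 = 1.
Proof.
apply: EFin_inj; rewrite gaussian_momentE -(integral_normal_pdf 0 s).
by apply: eq_integral => x _; rewrite mul1r.
Qed.

Lemma gaussian_moment1 : gaussian_moment 1 = 0.
Proof.
have := integral_pow_pdfS 0; rewrite -gaussian_momentE -EFinM.
under eq_integral do rewrite !mul0r; rewrite integral0 => -[] /esym/eqP.
by rewrite mulf_eq0 invr_eq0 expf_eq0/= (negbTE sn0) => /eqP.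
Qed.

Lemma gaussian_momentS k :
  gaussian_moment k.+2 = k.+1%:R * s ^+ 2 * gaussian_moment k.
Proof.
have := integral_pow_pdfS k.+1; rewrite -gaussian_momentE -EFinM.
under eq_integral do rewrite -mulrA EFinM.
rewrite integralZl//; last exact: integrable_pow_pdf.
rewrite -gaussian_momentE -EFinM => -[] e.
by rewrite mulrAC e; field.
Qed.

Lemma integrable_normal_pow k :
  (@normal_prob R 0 s).-integrable setT (fun x => (x ^+ k)%:E).
Proof.
have mk : measurable_fun [set: R] (fun x : R => x ^+ k) by exact: exprn_measurable.
apply/integrableP; split; first exact/measurable_EFinP.
have /integrableP[_] := integrable_pow_pdf k.
rewrite -(pdf_integral (g := fun x => `|x ^+ k|)); last exact: measurableT_comp.
apply: le_lt_trans; rewrite le_eqVlt; apply/orP; left; apply/eqP.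
apply: eq_integral => x _; rewrite /= normrM [Num.norm (pdf x)]ger0_norm//.
exact: normal_pdf_ge0.
Qed.

End GaussianMoments.

(** * Complex expectations and Gaussian families *)

Section ComplexExpectation.
Context d (T : measurableType d) (R : realType) (P : probability T R).
Local Notation C := R[i].

Definition cintegrable (Z : T -> C) :=
  P.-integrable setT (fun t => (complex.Re (Z t))%:E) /\
  P.-integrable setT (fun t => (complex.Im (Z t))%:E).

Lemma cexpectationE (Z : T -> C) : cexpectation P Z =
  Rintegral P setT (fun t => complex.Re (Z t)) +i*
  Rintegral P setT (fun t => complex.Im (Z t)).
Proof. by rewrite /cexpectation /Rintegral !unlock. Qed.

Lemma cexpectationD (Z W : T -> C) : cintegrable Z -> cintegrable W ->
  cintegrable (fun t => Z t + W t) /\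
  cexpectation P (fun t => Z t + W t) = cexpectation P Z + cexpectation P W.
Proof.
move=> [Z1 Z2] [W1 W2].
have eR t : complex.Re (Z t + W t) = complex.Re (Z t) + complex.Re (W t).
  by case: (Z t) (W t) => ? ? [].
have eI t : complex.Im (Z t + W t) = complex.Im (Z t) + complex.Im (W t).
  by case: (Z t) (W t) => ? ? [].
rewrite !cexpectationE; split.
  split.
    by under eq_fun do rewrite eR EFinD; exact: integrableD.
  by under eq_fun do rewrite eI EFinD; exact: integrableD.
under eq_Rintegral => t _ do rewrite eR.
under [X in _ +i* X]eq_Rintegral => t _ do rewrite eI.
by rewrite !RintegralD.
Qed.

Lemma cexpectation_scale (Y : T -> R) (z : C) :
  P.-integrable setT (fun t => (Y t)%:E) ->
  cintegrable (fun t => (Y t)%:C * z) /\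
  cexpectation P (fun t => (Y t)%:C * z) = (Rintegral P setT Y)%:C * z.
Proof.
case: z => a b iY.
have eR t : complex.Re ((Y t)%:C * (a +i* b)) = Y t * a by rewrite /= mul0r subr0.
have eI t : complex.Im ((Y t)%:C * (a +i* b)) = Y t * b by rewrite /= mul0r addr0.
rewrite !cexpectationE; split.
  split.
    by under eq_fun do rewrite eR EFinM; exact: integrableZr.
  by under eq_fun do rewrite eI EFinM; exact: integrableZr.
under eq_Rintegral => t _ do rewrite eR.
under [X in _ +i* X]eq_Rintegral => t _ do rewrite eI.
by rewrite !RintegralZr//; simpc.
Qed.

Lemma cexpectationZ (k : C) (Z : T -> C) : cintegrable Z ->
  cexpectation P (fun t => k * Z t) = k * cexpectation P Z.
Proof.
move=> [iR iI].
have [j1 e1] := cexpectation_scale k iR.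
have [j2 e2] := cexpectation_scale (k * 'i%C) iI.
have -> : (fun t => k * Z t) = (fun t => (complex.Re (Z t))%:C * k +
    (complex.Im (Z t))%:C * (k * 'i%C)).
  apply/funext => t; rewrite {1}[Z t]complexE mulrDr mulrC; congr (_ + _).
  by rewrite [LHS]mulrA [LHS]mulrC.
rewrite (cexpectationD j1 j2).2 e1 e2 cexpectationE.
set x := Rintegral _ _ _; set y := Rintegral _ _ _.
rewrite [x +i* y]complexE/= mulrDr; congr (_ + _); first exact: mulrC.
by rewrite [RHS]mulrA [LHS]mulrC.
Qed.

Lemma cexpectation_sum (n : nat) (Z : nat -> T -> C) :
  (forall a, (a < n)%N -> cintegrable (Z a)) ->
  cintegrable (fun t => \sum_(a < n) Z a t) /\
  cexpectation P (fun t => \sum_(a < n) Z a t) = \sum_(a < n) cexpectation P (Z a).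
Proof.
elim: n => [_|n IH iZ].
  have -> : (fun t => \sum_(a < 0) Z a t) = (fun t => (cst 0 t)%:C * 0).
    by apply/funext => t; rewrite big_ord0 mulr0.
  have [i0 ->] := @cexpectation_scale (cst 0) 0 (integrable0 _ _).
  by split; rewrite // mulr0 big_ord0.
have [i1 e1] := IH (fun a an => iZ a (ltnW an)).
have [i2 e2] := cexpectationD i1 (iZ n (ltnSn n)).
have -> : (fun t => \sum_(a < n.+1) Z a t) = (fun t => \sum_(a < n) Z a t + Z n t).
  by apply/funext => t; rewrite big_ord_recr.
by split => //; rewrite e2 e1 big_ord_recr.
Qed.

Lemma cexpectation_boxsum n K (Y : seq nat -> T -> R) (F : seq nat -> C) :
  (forall s, below n s -> P.-integrable setT (fun t => (Y s t)%:E)) ->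
  cintegrable (fun t => boxsum n K (fun s => (Y s t)%:C * F s)) /\
  cexpectation P (fun t => boxsum n K (fun s => (Y s t)%:C * F s)) =
  boxsum n K (fun s => (Rintegral P setT (Y s))%:C * F s).
Proof.
elim: K Y F => [|K IH] Y F iY /=; first by apply: cexpectation_scale; exact: iY.
have H a : (a < n)%N -> _ :=
  fun an => IH (fun s => Y (a :: s)) (fun s => F (a :: s))
    (fun s sn => iY (a :: s) (introT andP (conj an sn))).
have [h1 ->] := cexpectation_sum (fun a an => (H a an).1).
by split=> //; apply: eq_bigr => a _; rewrite (H a (ltn_ord a)).2.
Qed.

End ComplexExpectation.

Section GaussianFamily.
Context d (T : measurableType d) (R : realType) (P : probability T R).
Variables (X : nat -> T -> R) (n : nat) (s : R).
Hypothesis s0 : 0 < s.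
Hypothesis mX : forall j, measurable_fun setT (X j).
Hypothesis lawX : forall j B, measurable B ->
  P (X j @^-1` B) = normal_prob 0 s B.
Hypothesis indepX : forall B : nat -> set R, (forall j, measurable (B j)) ->
  P (\bigcap_(j in [set` iota 0 n]) (X j @^-1` B j)) =
  (\prod_(j <- iota 0 n) P (X j @^-1` B j))%E.

Local Notation moment := (gaussian_moment s).

Let lawE j B : measurable B ->
  (\int[P]_t (\1_B (X j t) * (cst 1 t : R))%:E = @normal_prob R 0 s B)%E.
Proof.
move=> mB; rewrite -(lawX j mB).
have mXB : measurable (X j @^-1` B) by rewrite -[_ @^-1` _]setTI; exact: mX.
rewrite -[RHS]/(P _) -[X in P X]setIT -integral_indic//.
by apply: eq_integral => t _; rewrite mulr1 !indicE.
Qed.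

Let m1 : measurable_fun setT (cst 1 : T -> R).
Proof. exact: measurable_cst. Qed.

Lemma integrable_gaussian_pow j k :
  P.-integrable setT (fun t => (X j t ^+ k)%:E).
Proof.
have mk : measurable_fun [set: R] (fun x : R => x ^+ k) by exact: exprn_measurable.
have := @integrable_density _ _ _ _ _ P (@normal_prob R 0 s) (X j) (cst 1)
  (mX j) m1 (fun=> ler01) (lawE j) _ mk (integrable_normal_pow s0 k).
by under eq_fun do rewrite mulr1.
Qed.

Lemma Rintegral_gaussian_pow j k :
  Rintegral P setT (fun t => X j t ^+ k) = moment k.
Proof.
have mk : measurable_fun [set: R] (fun x : R => x ^+ k) by exact: exprn_measurable.
rewrite /gaussian_moment /Rintegral.
rewrite -(@integral_density _ _ _ _ _ P (@normal_prob R 0 s) (X j) (cst 1)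
  (mX j) m1 (fun=> ler01) (lawE j) _ mk).
by congr fine; apply: eq_integral => t _; rewrite mulr1.
Qed.

Lemma prod_count (u : seq nat) t : below n u ->
  \prod_(a <- u) X a t = \prod_(j <- iota 0 n) X j t ^+ count_mem j u.
Proof.
elim: u => [|a u IH]; first by rewrite big_nil big1.
move=> /andP[an un]; rewrite big_cons IH//=.
have aI : a \in iota 0 n by rewrite mem_iota add0n.
rewrite !(bigD1_seq a)//= ?iota_uniq// eqxx exprS -mulrA; congr (_ * (_ * _)).
by apply: eq_bigr => j /negbTE ja; rewrite eq_sym ja.
Qed.

Lemma integrable_gaussian_prod (u : seq nat) : below n u ->
  P.-integrable setT (fun t => (\prod_(a <- u) X a t)%:E).
Proof.
move=> un; under eq_fun do rewrite prod_count//.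
apply: (integrable_indep_prod mX (iota_uniq 0 n) indepX
  (g := fun j x => x ^+ count_mem j u)).
  by move=> j; exact: exprn_measurable.
by move=> j; exact: integrable_gaussian_pow.
Qed.

Lemma Rintegral_gaussian_prod (u : seq nat) : below n u ->
  Rintegral P setT (fun t => \prod_(a <- u) X a t) = gmoment moment n u.
Proof.
move=> un; under eq_Rintegral do rewrite prod_count//.
rewrite (expectation_indep_prod mX (iota_uniq 0 n) indepX
  (g := fun j x => x ^+ count_mem j u)).
- rewrite /gmoment -(big_mkord xpredT (fun j => moment (count_mem j u))).
  rewrite /index_iota subn0.
  by apply: eq_bigr => j _; exact: Rintegral_gaussian_pow.
- by move=> j; exact: exprn_measurable.
- by move=> j; exact: integrable_gaussian_pow.
Qed.

(** By independence the expectation of a monomial in the variables is a product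
    of moments of single variables, which is what [wick] expands. *)
Theorem gaussian_wick K (F : seq nat -> R[i]) :
  cexpectation P (fun t => boxsum n K (fun u => (\prod_(a <- u) X a t)%:C * F u)) =
  (s ^+ 2)%:C ^+ K./2 * \sum_(q <- pairings K)
     boxsum n K./2 (fun u => F (map (nth 0%N u) q)).
Proof.
rewrite (cexpectation_boxsum _ _ integrable_gaussian_prod).2.
rewrite -(@wick _ _ (fun k => (moment k)%:C)).
- apply: eq_boxsum => u _ un; rewrite Rintegral_gaussian_prod// mulrC.
  by rewrite /gmoment rmorph_prod.
- by rewrite gaussian_moment0.
- by rewrite gaussian_moment1.
- by move=> m; rewrite gaussian_momentS// !rmorphM/= rmorph_nat.
Qed.

End GaussianFamily.

(** * The trace of a word as a sum over walks *)

Lemma mvt_lip (R : realType) (f df : R -> R) (B x y : R) :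
  (forall z : R, is_derive z 1 f (df z)) -> (forall z, `|df z| <= B) ->
  `|f x - f y| <= B * `|x - y|.
Proof.
move=> fdf dfB; wlog xy : x y / x <= y.
  move=> H; have [/H//|/ltW yx] := leP x y.
  by rewrite (distrC x) (distrC (f x)); exact: H.
have cf : {within `[x, y], continuous f}.
  apply: continuous_subspaceT => z; apply: differentiable_continuous.
  by apply/derivable1_diffP; exact: ex_derive.
have [z _ e] := MVT_segment xy (fun z _ => fdf z) cf.
by rewrite (distrC x) (distrC (f x)) e normrM ler_wpM2r.
Qed.

Section Waves.
Variables (R : realType) (theta : R).
Local Notation C := R[i].

Definition wave (b : bool) (x : R) : C := expi ((if b then - theta else theta) * x).

Lemma expi0 : expi (0 : R) = 1.
Proof. by rewrite /expi cos0 sin0. Qed.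

Lemma expiD (x y : R) : expi (x + y) = expi x * expi y.
Proof. by rewrite /expi cosD sinD; simpc; rewrite [X in _ +i* X]addrC. Qed.

Lemma expiX (x : R) k : expi x ^+ k = expi (x * k%:R).
Proof.
elim: k => [|k IH]; first by rewrite expr0 mulr0 expi0.
by rewrite exprS IH -expiD mulrS mulrDr mulr1.
Qed.

Lemma conj_expi (x : R) : Num.conj (expi x) = expi (- x).
Proof. by rewrite /expi cosN sinN. Qed.

Lemma norm_expi (x : R) : `|expi x| = 1.
Proof. by rewrite normc_def/= cos2Dsin2 sqrtr1. Qed.

Lemma norm_wave b x : `|wave b x| <= 1.
Proof. by rewrite norm_expi. Qed.

Lemma expi_lip (x y : R) : `|expi x - expi y| <= (2 * `|x - y|)%:C.
Proof.
apply: (le_trans (norm_complex_le _)); rewrite lecR Re_sub Im_sub/=.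
rewrite mulr2n mulrDl; apply: lerD.
  by apply: (mvt_lip (df := fun z => - sin z)) => z; rewrite normrN sin_max.
by apply: (mvt_lip (df := cos)) => z; exact: cos_max.
Qed.

Lemma wave_lip b x y : `|wave b x - wave b y| <= (2 * `|theta| * `|x - y|)%:C.
Proof.
apply: (le_trans (expi_lip _ _)); rewrite lecR -mulrBr normrM mulrA.
by case: b; rewrite ?normrN.
Qed.

End Waves.

Section TraceExpansion.
Variables (R : realType) (theta : R).
Local Notation C := R[i].
Local Notation letter := ('I_2 * bool)%type.

Definition circ_letter (l : letter) := l.1 == ord0.

Definition step (b : bool) : int := if b then -1 else 1.

(** The product of the phases met by the walk that starts at [z] and whose
    circulant letters move by the entries of [s]. The walk is kept in the
    integers and reduced modulo n only when a phase is read off, so that its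
    positions are linear in [z] and [s]. *)
Fixpoint phase (n : nat) (Q : seq letter) (z : int) (s : seq nat) : C :=
  if Q is l :: Q' then
    if circ_letter l then phase n Q' (z + step l.2 * (head 0%N s)%:Z) (behead s)
    else wave theta l.2 (circpos R n z) * phase n Q' z s
  else 1.

Fixpoint ending (Q : seq letter) (z : int) (s : seq nat) : int :=
  if Q is l :: Q' then
    if circ_letter l then ending Q' (z + step l.2 * (head 0%N s)%:Z) (behead s)
    else ending Q' z s
  else z.

Definition site (n : nat) (z : int) : 'I_n.+1 := Ordinal (resid_lt z (ltn0Sn n)).

Lemma site_nat n (i : 'I_n.+1) : site n (val i)%:Z = i.
Proof.
apply/val_inj => /=; apply/eqP; rewrite -eqz_nat residE// modz_small//.
by rewrite /= ltz_nat ltn_ord.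
Qed.

Lemma sum_site (V : nmodType) n (F : 'I_n.+1 -> V) b z :
  \sum_k F k = \sum_(a < n.+1) F (site n (z + step b * (val a)%:Z)).
Proof.
pose G r := F (inord r).
transitivity (\sum_(r < n.+1) G r).
  by apply: eq_bigr => r _; rewrite /G inord_val.
rewrite -(@sum_resid_shift _ _ G (step b) z); last by case: b.
apply: eq_bigr => a _; rewrite /G; congr F; apply/val_inj => /=.
by rewrite inordK// resid_lt.
Qed.

Lemma resid_congr n (x y : int) : (0 < n)%N -> (x = y %[mod n%:Z])%Z ->
  resid n x = resid n y.
Proof. by move=> n0 xy; apply/eqP; rewrite -eqz_nat !residE// xy. Qed.

Lemma resid_small n a : (a < n)%N -> resid n a%:Z = a.
Proof.
move=> an; apply/eqP; rewrite -eqz_nat residE ?(leq_trans _ an)//.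
by rewrite modz_small.
Qed.

Lemma modn_resid n (z : nat) : (0 < n)%N -> (z %% n)%N = resid n z%:Z.
Proof. by move=> n0; apply/eqP; rewrite -eqz_nat residE// modz_nat. Qed.

Lemma circ_site n (c : nat -> R) z (a : 'I_n.+1) :
  circ n.+1 c (site n z) (site n (z + a%:Z)) = (c a)%:C.
Proof.
rewrite mxE /=; congr (c _)%:C; rewrite modn_resid// -[RHS](resid_small (ltn_ord a)).
apply: resid_congr => //; rewrite -subzn; last first.
  by rewrite (leq_trans (ltnW (resid_lt _ _)))// leq_addl.
apply/eqP; rewrite eqz_mod_dvd PoszD !residE// /modz.
apply/dvdzP; exists (1 - ((z + a%:Z) %/ n.+1%:Z)%Z + (z %/ n.+1%:Z)%Z).
by ring.
Qed.

(** Row z of the circulant matrix has the entry c_a in column z + a, and row z of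
    its adjoint has it in column z - a. *)
Lemma letter_circ n (c : nat -> R) b z (M : 'M[C]_n.+1) j :
  ((if b then star (circ n.+1 c) else circ n.+1 c : 'M[C]_n.+1) * M) (site n z) j =
  \sum_(a < n.+1) (c a)%:C * M (site n (z + step b * (val a)%:Z)) j.
Proof.
rewrite mxE (sum_site _ b z); apply: eq_bigr => a _; congr (_ * _).
case: b; last by rewrite mul1r circ_site.
have -> : site n z = site n (z + step true * a%:Z + a%:Z).
  by congr site; rewrite mulN1r subrK.
set y := z + _.
transitivity (Num.conj (circ n.+1 c (site n y) (site n (y + a%:Z)))).
  by rewrite !mxE.
by rewrite circ_site; exact: conjc_real.
Qed.

Lemma letter_diag n b z (M : 'M[C]_n.+1) j :
  ((if b then star (Dmx n.+1 theta) else Dmx n.+1 theta : 'M[C]_n.+1) * M)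
    (site n z) j = wave theta b (circpos R n.+1 z) * M (site n z) j.
Proof.
have E : expi (theta / n.+1%:R) ^+ (resid n.+1 z) = wave theta false (circpos R n.+1 z).
  by rewrite expiX /wave /circpos mulrAC -mulrA.
rewrite mxE (bigD1 (site n z))//= big1 ?addr0 => [|k kz].
  congr (_ * _); case: b; rewrite !mxE eqxx mulr1n E//.
  by rewrite -[LHS]/(Num.conj _) conj_expi /wave mulNr.
case: b; rewrite !mxE eq_sym.
  by rewrite eq_sym (negbTE kz) mulr0n conjC0 mul0r.
by rewrite (negbTE kz) mulr0n mul0r.
Qed.

Definition circ_count (Q : seq letter) := count circ_letter Q.

(** Expanding the product from the left, each circulant letter makes the walk
    choose a move and each diagonal letter contributes a phase. *)
Lemma word_entry n (c : nat -> R) (x : C) (Q : seq letter) z j :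
  Num.conj x = x ->
  (\prod_(l <- Q) (if l.2 then star (tnth [tuple x *: circ n.+1 c; Dmx n.+1 theta] l.1)
     else tnth [tuple x *: circ n.+1 c; Dmx n.+1 theta] l.1) : 'M[C]_n.+1) (site n z) j =
  x ^+ circ_count Q * boxsum n.+1 (circ_count Q) (fun s =>
    (\prod_(a <- s) c a)%:C *
    (phase n.+1 Q z s * (site n (ending Q z s) == j)%:R)).
Proof.
move=> xx; elim: Q z => [|[i b] Q IH] z.
  by rewrite !big_nil/= big_nil !mul1r mxE.
rewrite big_cons; set M := \prod_(l <- Q) _; rewrite -/M in IH.
have [i0|i0] := eqVneq i ord0.
  rewrite {}i0 (_ : (if _ then _ else _) =
    x *: (if b then star (circ n.+1 c) else circ n.+1 c : 'M[C]_n.+1)); last first.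
    by case: b => //=; rewrite starZ xx.
  rewrite -scalerAl mxE letter_circ /circ_count/= add1n exprS -mulrA.
  congr (_ * _); rewrite mulr_sumr; apply: eq_bigr => a _.
  rewrite IH mulrCA; congr (_ * _); rewrite -boxsumMl.
  by apply: eq_boxsum => s _ _; rewrite big_cons rmorphM/= !mulrA.
have i1 : i = @Ordinal 2 1 isT by apply/val_inj; case: i i0 => -[|[|]].
rewrite {}i1 (_ : (if _ then _ else _) =
    (if b then star (Dmx n.+1 theta) else Dmx n.+1 theta : 'M[C]_n.+1)); last by case: b.
rewrite letter_diag IH mulrCA /circ_count/= add0n; congr (_ * _).
rewrite -boxsumMl; apply: eq_boxsum => s _ _.
by rewrite mulrCA; congr (_ * _); rewrite mulrA.
Qed.

End TraceExpansion.

Section PhiWord.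
Variables (R : realType) (theta : R).
Local Notation C := R[i].
Local Notation letter := ('I_2 * bool)%type.

(** Entry 0 of [v] is the starting point of the walk; the entry p + 1 is the move
    shared by the two letters of pair p. *)
Definition reindexed (q v : seq nat) := [seq nth 0%N (behead v) p | p <- q].

(** The contribution of a pairing: the phases of the closed walks, averaged over
    all starting points and moves. *)
Definition pair_term (Q : seq letter) (q : seq nat) (n : nat) : C :=
  let h := (circ_count Q)./2 in
  (n ^ h.+1)%N%:R^-1 * boxsum n h.+1 (fun v =>
    phase theta n Q (head 0%N v)%:Z (reindexed q v) *
    (resid n (ending Q (head 0%N v)%:Z (reindexed q v)) == head 0%N v)%:R).

Context d (T : measurableType d) (P : probability T R).
Variable c : nat -> {RV P >-> R}.
Hypothesis c_indep : mutually_independent c.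
Hypothesis c_gauss : forall j, standard_gaussian (c j).

Let c_indep_iota n (B : nat -> set R) : (forall j, measurable (B j)) ->
  P (\bigcap_(j in [set` iota 0 n]) (c j @^-1` B j)) =
  (\prod_(j <- iota 0 n) P (c j @^-1` B j))%E.
Proof.
move=> mB; have := c_indep [fset j in iota 0 n]%fset mB.
have -> : [set` [fset j in iota 0 n]%fset] = [set` iota 0 n].
  by apply/seteqP; split=> j /=; rewrite !inE.
move=> ->; apply: perm_big; apply: uniq_perm; rewrite ?iota_uniq ?fset_uniq//.
by move=> j; rewrite !inE.
Qed.

(** The factor n^(-1/2) of each circulant letter and the factor n^(-1) of the
    trace make up the normalisation of [pair_term]. *)
Theorem phi_word (Q : monomial C 2) n :
  phi P (fun w => meval Q
    [tuple (Num.sqrt n.+1%:R)^-1%:C *: circ n.+1 (fun j => c j w); Dmx n.+1 theta]) =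
  Q.1 * \sum_(q <- pairings (circ_count Q.2)) pair_term Q.2 q n.+1.
Proof.
case: Q => k Q /=; rewrite /phi.
set x : C := (_^-1)%:C; have xx : Num.conj x = x by exact: conjc_real.
set K := circ_count Q.
pose F s : C := k * x ^+ K * \sum_(i < n.+1) phase theta n.+1 Q (val i)%:Z s *
  (resid n.+1 (ending Q (val i)%:Z s) == i)%:R.
have trE w : \tr (meval (k, Q) [tuple x *: circ n.+1 (fun j => c j w); Dmx n.+1 theta]) =
    boxsum n.+1 K (fun s => (\prod_(a <- s) c a w)%:C * F s).
  rewrite /meval/= linearZ/= /mxtrace (eq_bigr (fun i : 'I_n.+1 => x ^+ K *
    boxsum n.+1 K (fun s => (\prod_(a <- s) c a w)%:C *
      (phase theta n.+1 Q (val i)%:Z s *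
      (resid n.+1 (ending Q (val i)%:Z s) == i)%:R)))); last first.
    by move=> i _; rewrite -{1}(site_nat i) word_entry.
  rewrite -mulr_sumr mulrA /F.
  rewrite (@eq_boxsum _ n.+1 K _ (fun s => k * x ^+ K *
    \sum_(i < n.+1) (\prod_(a <- s) c a w)%:C * (phase theta n.+1 Q (val i)%:Z s *
    (resid n.+1 (ending Q (val i)%:Z s) == i)%:R))); last first.
    by move=> s _ _; rewrite mulrCA -mulr_sumr.
  by rewrite boxsumMl boxsum_sum.
under [X in cexpectation P X]eq_fun do rewrite trE.
rewrite (@gaussian_wick _ _ _ P (fun j => c j) n.+1 1); last 4 first.
- exact: ltr01.
- by move=> j; exact: measurable_funPT.
- by move=> j B mB; rewrite -(c_gauss j mB).
- exact: c_indep_iota.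
rewrite expr1n expr1n mul1r !mulr_sumr [LHS]big_seq [RHS]big_seq.
apply: eq_bigr => q /pairings_size[qK Ke].
rewrite /F boxsumMl mulrCA -mulrA; congr (_ * _).
rewrite /pair_term boxsum_recr/= !mulrA.
congr (_ * _).
have n0 : n.+1%:R != 0 :> R by rewrite pnatr_eq0.
rewrite -[in X in x ^+ X](even_halfK Ke) -muln2 mulnC exprM.
have -> : x ^+ 2 = n.+1%:R^-1.
  by rewrite /x -rmorphXn/= exprVn sqr_sqrtr// fmorphV rmorph_nat.
by rewrite expnS natrM invfM mulrC exprVn natrX.
Qed.

End PhiWord.

(** * The limit of the contribution of a pairing *)

Section CongruenceCount.

Lemma resid_eq n a (y : int) : (a < n)%N ->
  (resid n (a%:Z + y) == a) = (n%:Z %| y)%Z.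
Proof.
move=> an; have n0 : (0 < n)%N by exact: leq_ltn_trans an.
rewrite -{2}(resid_small an) -eqz_nat !residE// eqz_mod_dvd.
by rewrite addrAC subrr add0r.
Qed.

(** For b > 0 the numbers b a lie among b n consecutive integers, which contain
    each residue modulo n exactly b times. *)
Lemma sum_congruence n (b c : int) : b != 0 ->
  (\sum_(a < n) (n%:Z %| (c + b * (val a)%:Z)%R)%Z <= `|b|)%N.
Proof.
case: n => [|n] b0; first by rewrite big_ord0.
wlog b1 : b c b0 / 0 < b.
  move=> H; have [/(H b c b0)//|] := ltP 0 b; rewrite le_eqVlt (negbTE b0)/= => bn.
  have := H (- b) (- c); rewrite oppr_eq0 oppr_gt0 abszN => /(_ b0 bn).
  apply: leq_trans; apply: leq_sum => a _.
  by rewrite mulNr -opprD !dvdzE abszN.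
have [m bE] : exists m : nat, b = m.+1%:Z.
  by exists `|b|.-1%N; case: b b0 b1 => [[|k]|k].
rewrite {}bE absz_nat.
pose f y := ((n.+1%:Z %| (c + y%:Z)%R)%Z : nat).
apply: (@leq_trans (\sum_(0 <= y < n.+1 * m.+1) f y)%N).
  rewrite big_nat_mul big_mkord; apply: leq_sum => a _.
  rewrite -{1}[(a * m.+1)%N]add0n big_addn mulSn addnK big_mkord.
  rewrite big_ord_recl/= /f add0n.
  by rewrite PoszM mulrC leq_addr.
rewrite mulnC big_nat_mul big_mkord.
rewrite (eq_bigr (fun=> 1%N)) ?sum_nat_const ?card_ord ?muln1// => k _.
rewrite -{1}[(k * n.+1)%N]add0n big_addn mulSn addnK big_mkord.
rewrite (eq_bigr (fun a : 'I_n.+1 => (resid n.+1 (c + 1 * (val a)%:Z) == 0%N : nat))).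
  rewrite (@sum_resid_shift nat n.+1 (fun r => (r == 0%N : nat)) 1 c)//.
  by rewrite big_ord_recl big1.
move=> a _; rewrite /f; congr nat_of_bool.
rewrite -[resid _ _](_ : resid n.+1 (0%:Z + (c + (a + k * n.+1)%N%:Z)) = _).
  by rewrite resid_eq.
apply: resid_congr => //; rewrite add0r PoszD PoszM mul1r addrA.
by rewrite addrC modzMDl.
Qed.

End CongruenceCount.

Section LinearCount.

(** When the other indices are fixed, [sum_congruence] leaves at most |L p|
    values to index p. *)
Lemma boxsum_congruence (T : numDomainType) n h (L : nat -> int) (c : int) p :
  (p < h)%N -> L p != 0 ->
  boxsum n h (fun u => ((n%:Z %| c + linform h L u)%Z)%:R) <=
  (`|L p|%N)%:R * (n ^ h.-1)%N%:R :> T.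
Proof.
elim: h L c p => [//|h IH] L c [|p] ph Lp.
  rewrite boxsum_recr -boxsum_const; apply: ler_boxsum => u _ _.
  rewrite -natr_sum ler_nat.
  apply: leq_trans (sum_congruence n (c + linform h (L \o succn) u) Lp).
  by apply: leq_sum => a _; rewrite linform_cons addrA addrAC.
have h0 : (0 < h)%N by case: (h) ph.
apply: (@le_trans _ _ (\sum_(a < n) (`|L p.+1|%N)%:R * (n ^ h.-1)%N%:R)).
  rewrite /=; apply: ler_sum => a _.
  rewrite (@eq_boxsum _ n h _ (fun u =>
    ((n%:Z %| (c + L 0%N * (val a)%:Z) + linform h (L \o succn) u)%Z)%:R)).
    exact: (IH (L \o succn) _ p).
  by move=> u _ _; rewrite linform_cons addrA.
rewrite sumr_const card_ord -[leLHS]mulr_natr -mulrA -natrM.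
by rewrite -expnSr prednK.
Qed.

End LinearCount.

Section PairTerm.
Variables (R : realType) (theta : R).
Local Notation C := R[i].
Local Notation letter := ('I_2 * bool)%type.
Implicit Types (Q : seq letter) (L : nat -> int) (q : seq nat).

Definition bump_form L p (e : int) : nat -> int :=
  fun r => L r + (if r == p then e else 0).

(** The position of the walk at a diagonal letter is a linear form in the
    starting point and the moves of the pairs. [L] holds the coefficients of the
    moves accumulated so far; the coefficient one of the starting point is
    supplied by [shifted]. *)
Fixpoint forms Q L q : seq ((nat -> int) * bool) :=
  if Q is l :: Q' then
    if circ_letter l then forms Q' (bump_form L (head 0%N q) (step l.2)) (behead q)
    else (L, l.2) :: forms Q' L q
  else [::].

Fixpoint final_form Q L q : nat -> int :=
  if Q is l :: Q' then
    if circ_letter l then final_form Q' (bump_form L (head 0%N q) (step l.2)) (behead q)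
    else final_form Q' L q
  else L.

Lemma linform_bump h L p e v : (p < h)%N ->
  linform h.+1 (shifted (bump_form L p e)) v =
  linform h.+1 (shifted L) v + e * (nth 0%N (behead v) p)%:Z.
Proof.
move=> ph; rewrite /linform (bigD1 (Ordinal (ph : (p.+1 < h.+1)%N)))//=.
rewrite [in RHS](bigD1 (Ordinal (ph : (p.+1 < h.+1)%N)))//=.
rewrite /bump_form eqxx mulrDl -nth_behead -!addrA; congr (_ + _).
rewrite addrC; congr (_ + _); apply: eq_bigr => -[[|r] rh]//.
by rewrite -val_eqE/= eqSS => /negbTE ->; rewrite addr0.
Qed.

Lemma phase_forms n h Q L q v : below h q -> (circ_count Q <= size q)%N ->
  phase theta n Q (linform h.+1 (shifted L) v) (reindexed q v) =
  \prod_(f <- forms Q L q)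
     wave theta f.2 (circpos R n (linform h.+1 (shifted f.1) v)).
Proof.
elim: Q L q => [|l Q IH] L q qh qs; first by rewrite big_nil.
rewrite /=; move: qs; rewrite /circ_count/=; case: ifP => lc; last first.
  by rewrite add0n big_cons => qs; rewrite IH.
case: q qh => [//|p q] /andP[ph qh] qs.
by rewrite -IH//= linform_bump.
Qed.

Lemma ending_form h Q L q v : below h q -> (circ_count Q <= size q)%N ->
  ending Q (linform h.+1 (shifted L) v) (reindexed q v) =
  linform h.+1 (shifted (final_form Q L q)) v.
Proof.
elim: Q L q => [//|l Q IH] L q qh qs.
rewrite /=; move: qs; rewrite /circ_count/=; case: ifP => lc; last first.
  by rewrite add0n => qs; rewrite IH.
case: q qh => [//|p q] /andP[ph qh] qs.
by rewrite -IH//= linform_bump.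
Qed.

Definition closing Q q : nat -> int := final_form Q (fun=> 0) q.

(** The move of a pair enters the total displacement with the sum of the steps
    of its two letters, which vanishes if and only if exactly one of them is an
    adjoint. *)
Definition balanced Q q : bool :=
  all (fun p => closing Q q p == 0) (iota 0 (circ_count Q)./2).

Lemma pairings_below K q : q \in pairings K -> below K./2 q.
Proof.
move=> qK; apply/allP => p pq; have := pairings_count p qK.
case: ltnP => // _ /eqP; rewrite double0 -leqn0 leqNgt -has_count => /hasP[].
by exists p => /=.
Qed.

Lemma pair_termE Q q n : q \in pairings (circ_count Q) ->
  pair_term theta Q q n = (n ^ (circ_count Q)./2.+1)%N%:R^-1 *
  boxsum n (circ_count Q)./2.+1 (fun v =>
    phase_prod (wave theta) (circ_count Q)./2 (forms Q (fun=> 0) q) n v *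
    ((n%:Z %| linform (circ_count Q)./2 (closing Q q) (behead v))%Z)%:R).
Proof.
move=> qK; have qh := pairings_below qK; have [qs _] := pairings_size qK.
rewrite /pair_term; congr (_ * _); apply: eq_boxsum => -[//|a u] _ /andP[an un].
have zE : a%:Z = linform (circ_count Q)./2.+1 (shifted (fun=> 0)) (a :: u).
  by rewrite linform_cons/= mul1r /linform big1 ?addr0// => r _; rewrite mul0r.
rewrite [head _ _]/= {1 2}zE phase_forms ?qs// ending_form ?qs//; congr (_ * _).
by rewrite linform_cons [shifted _ 0%N]/= mul1r resid_eq.
Qed.

(** A nonzero coefficient in the closing form makes the closing of the walk a
    nontrivial congruence, which loses a factor n. *)
Lemma pair_term_unbalanced Q q : q \in pairings (circ_count Q) -> ~~ balanced Q q ->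
  (fun n => pair_term theta Q q n.+1) @ \oo --> (0 : C^o).
Proof.
move=> qK /allPn[p]; rewrite mem_iota add0n => /andP[_ ph] bp.
set b := closing Q q p in bp.
apply: (@cvg_near_limit R _ (fun=> 0) 0 `|b|%N%:R); last exact: (@cvg_cst C^o).
move=> n; rewrite subr0 pair_termE// normrM ger0_norm ?invr_ge0 ?ler0n//.
set h := (circ_count Q)./2 in ph *.
have h0 : (0 < h)%N by case: (h) ph.
rewrite mulrC ler_pdivrMr ?ltr0n ?expn_gt0//.
apply: (le_trans (ler_norm_boxsum _ _ _)).
apply: (@le_trans _ _ (boxsum n.+1 h.+1 (fun v =>
    ((n.+1%:Z %| 0 + linform h (closing Q q) (behead v))%Z)%:R))).
  apply: ler_boxsum => v _ _; rewrite add0r normrM [X in _ * X]ger0_norm ?ler0n//.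
  rewrite ler_piMl ?ler0n// /phase_prod (big_morph _ (@normrM C) (normr1 _)).
  by apply: prodr_ile1 => f _; rewrite normr_ge0 norm_wave.
rewrite /= sumr_const card_ord -[leLHS]mulr_natr.
have := @boxsum_congruence C n.+1 h (closing Q q) 0 p ph bp.
move/(ler_wpM2r (ler0n C n.+1))/le_trans; apply.
rewrite -mulrA -natrM -expnSr prednK//.
rewrite -/b expnSr natrM rmorphM/= fmorphV/= !rmorph_nat.
by rewrite -!mulrA ler_wpM2l// mulrCA mulVf ?mulr1// pnatr_eq0.
Qed.

(** The closing form is zero, so all walks close. *)
Lemma pair_term_balanced Q q n : q \in pairings (circ_count Q) -> balanced Q q ->
  pair_term theta Q q n =
  average (wave theta) (circ_count Q)./2 (forms Q (fun=> 0) q) n.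
Proof.
move=> qK /allP gq; rewrite pair_termE// /average; congr (_ * _).
apply: eq_boxsum => v _ _; rewrite /linform big1 ?dvdz0 ?mulr1// => p _.
have := gq (val p); rewrite mem_iota add0n ltn_ord => /(_ isT)/eqP ->.
by rewrite mul0r.
Qed.

Theorem pair_term_cvg Q q : q \in pairings (circ_count Q) ->
  exists l : C, (fun n => pair_term theta Q q n.+1) @ \oo --> (l : C^o).
Proof.
move=> qK; have [gq|bq] := boolP (balanced Q q); last first.
  by exists 0; exact: pair_term_unbalanced.
have lam0 : 0 <= 2 * `|theta| by rewrite mulr_ge0.
have [l lP] := refine_cvg (fun n m n0 m0 => average_refine
  (circ_count Q)./2 (forms Q (fun=> 0) q) lam0 (norm_wave theta) (wave_lip theta) n0 m0).
by exists l; under eq_fun do rewrite pair_term_balanced//.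
Qed.

Lemma forms_circ Q L q : all circ_letter Q -> forms Q L q = [::].
Proof. by elim: Q L q => [//|l Q IH] L q /= /andP[-> Qc]; exact: IH. Qed.

Lemma pair_term_circ Q q : all circ_letter Q -> q \in pairings (circ_count Q) ->
  (fun n => pair_term theta Q q n.+1) @ \oo --> ((balanced Q q)%:R : C^o).
Proof.
move=> Qc qK; have [gq|bq] := boolP (balanced Q q); last exact: pair_term_unbalanced.
under eq_fun => n do rewrite pair_term_balanced// forms_circ//.
rewrite (_ : (fun n => _) = fun=> 1); first exact: (@cvg_cst C^o).
apply/funext => n; rewrite /average (@eq_boxsum _ _ _ _ (fun=> 1)).
  by rewrite boxsum_const mul1r mulVf// pnatr_eq0 expn_eq0.
by move=> v _ _; rewrite /phase_prod big_nil.
Qed.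

End PairTerm.

(** * Riemann sums of exponentials *)

Section ComplexLimitOps.
Variable R : realType.
Local Notation C := R[i].

Lemma cvgC_add (a b : nat -> C) (l m : C) :
  a @ \oo --> (l : C^o) -> b @ \oo --> (m : C^o) ->
  (fun n => a n + b n) @ \oo --> (l + m : C^o).
Proof. exact: (@cvgD _ C^o). Qed.

Lemma cvgC_scale (k : C) (a : nat -> C) (l : C) :
  a @ \oo --> (l : C^o) -> (fun n => k * a n) @ \oo --> (k * l : C^o).
Proof. exact: (@cvgZl_tmp _ C^o). Qed.

Lemma cvgC_sum (I : eqType) (r : seq I) (a : I -> nat -> C) (l : I -> C) :
  (forall i, i \in r -> a i @ \oo --> (l i : C^o)) ->
  (fun n => \sum_(i <- r) a i n) @ \oo --> (\sum_(i <- r) l i : C^o).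
Proof.
elim: r => [|i r IH] H.
  by rewrite big_nil; under eq_fun do rewrite big_nil; exact: (@cvg_cst C^o).
rewrite big_cons; under eq_fun do rewrite big_cons.
apply: cvgC_add; first by apply: H; rewrite mem_head.
by apply: IH => j jr; apply: H; rewrite inE jr orbT.
Qed.

Lemma cvgC_unique (a : nat -> C) (l m : C) :
  a @ \oo --> (l : C^o) -> a @ \oo --> (m : C^o) -> l = m.
Proof. by move=> al am; exact: (@norm_cvg_unique _ C^o _ _ _ _ al am). Qed.

End ComplexLimitOps.

Section RiemannSums.
Variable R : realType.
Local Notation C := R[i].
Variables (F f : R -> R) (B : R).
Hypothesis dF : forall x : R, is_derive x 1 F (f x).
Hypothesis cf : continuous f.
Hypothesis f_lip : forall x y, `|f x - f y| <= B * `|x - y|.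

Let cF : continuous F.
Proof.
move=> x; apply: differentiable_continuous; apply/derivable1_diffP.
exact: ex_derive.
Qed.

(** On each of the n + 1 intervals the mean value theorem writes the increment of
    [F] as a value of [f] times the length, and this value is within B / (n + 1)
    of the value of [f] at the left end. *)
Lemma riemann_sum_bound n :
  `|n.+1%:R^-1 * (\sum_(a < n.+1) f (a%:R / n.+1%:R)) - (F 1 - F 0)| <= B / n.+1%:R.
Proof.
have n0 : 0 < n.+1%:R :> R by rewrite ltr0n.
pose x (a : nat) : R := a%:R / n.+1%:R.
have xS a : x a.+1 - x a = n.+1%:R^-1.
  by rewrite /x -mulrBl -natr1 addrAC subrr add0r mul1r.
have -> : F 1 - F 0 = \sum_(a < n.+1) (F (x a.+1) - F (x a)).
  rewrite -(big_mkord xpredT (fun a => F (x a.+1) - F (x a))) telescope_sumr//.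
  by rewrite /x mul0r divff// lt0r_neq0.
rewrite mulr_sumr -sumrB; apply: (le_trans (ler_norm_sum _ _ _)).
apply: (@le_trans _ _ (\sum_(a < n.+1) B / n.+1%:R / n.+1%:R)); last first.
  rewrite sumr_const card_ord -[leLHS]mulr_natr divfK// lt0r_neq0//.
apply: ler_sum => a _; rewrite -/(x a).
have xle : x a <= x a.+1 by rewrite -subr_ge0 xS invr_ge0 ltW.
have [y] := MVT_segment xle (fun z _ => dF z) (continuous_subspaceT cF).
rewrite in_itv/= => /andP[ay ya] ->; rewrite xS mulrC -mulrBl normrM.
have n0' : 0 <= n.+1%:R^-1 :> R by rewrite invr_ge0 ltW.
rewrite [X in _ * X]ger0_norm//; apply: ler_wpM2r => //.
apply: (le_trans (f_lip _ _)); apply: ler_wpM2l.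
  have := f_lip 1 0; rewrite subr0 normr1 mulr1; exact: le_trans.
rewrite distrC ger0_norm ?subr_ge0//; apply: (@le_trans _ _ (x a.+1 - x a)).
  by rewrite lerD2r.
by rewrite xS.
Qed.

Lemma integral_uniform01 :
  (\int[uniform01 R]_x (f x)%:E = (F 1 - F 0)%:E)%E.
Proof.
have mf : measurable_fun [set: R] f by exact: continuous_measurable_fun.
have dens A : measurable A ->
    (\int[@lebesgue_measure R]_x (\1_A x * uniform_pdf 0 1 x)%:E = uniform01 R A)%E.
  move=> mA; rewrite /uniform01 /uniform_prob [RHS]integral_mkcond.
  apply: eq_integral => x _; rewrite patchE indicE.
  by case: ifP => _; rewrite ?mul1r ?mul0r.
have H := @integral_density _ _ _ _ _ (@lebesgue_measure R) (uniform01 R) id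
  (uniform_pdf 0 1).
rewrite -H//; last 2 first.
- exact: measurable_uniform_pdf.
- by move=> x; apply: uniform_pdf_ge0.
rewrite EFinB -(@continuous_FTC2 _ f F 0 1 ltr01).
- rewrite [RHS]integral_mkcond; apply: eq_integral => x _; rewrite patchE.
  rewrite /uniform_pdf subr0 invr1 mem_setE in_itv/=.
  by case: ifP => _; rewrite ?mulr1 ?mulr0.
- exact: continuous_subspaceT.
- split=> [x _||]; first exact: ex_derive.
    exact/cvg_at_right_filter/cF.
  exact/cvg_at_left_filter/cF.
- by move=> x _; rewrite derive1E; exact: derive_val.
Qed.

End RiemannSums.

Section DiagonalMoments.
Variables (R : realType) (t : R).
Local Notation C := R[i].
Local Notation U := (uniform01 R).

Lemma mulid_derive (x : R) : is_derive x 1 (fun u => t * u) t.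
Proof.
have -> : (fun u => t * u) = t \*: (@id R) by [].
by apply: is_derive_eq; rewrite /GRing.scale/= mulr1.
Qed.

Let sin_t u := sin (t * u).
Let cos_t u := cos (t * u).

Let dsin (x : R) : is_derive x 1 sin_t (t * cos_t x).
Proof.
have H := mulid_derive x; have -> : sin_t = sin \o (fun u => t * u) by [].
by apply: is_derive_eq; rewrite mulrC.
Qed.

Let dcos (x : R) : is_derive x 1 cos_t (- (t * sin_t x)).
Proof.
have H := mulid_derive x; have -> : cos_t = cos \o (fun u => t * u) by [].
by apply: is_derive_eq; rewrite mulNr mulrC.
Qed.

Let cont (f df : R -> R) : (forall x : R, is_derive x 1 f (df x)) -> continuous f.
Proof.
move=> fd x; apply: differentiable_continuous; apply/derivable1_diffP.
exact: ex_derive.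
Qed.

Let sin_lip x y : `|sin_t x - sin_t y| <= `|t| * `|x - y|.
Proof.
apply: (@mvt_lip R sin_t (fun z => t * cos_t z) `|t| x y dsin) => z.
by rewrite normrM ler_piMr//; exact: cos_max.
Qed.

Let cos_lip x y : `|cos_t x - cos_t y| <= `|t| * `|x - y|.
Proof.
apply: (@mvt_lip R cos_t (fun z => - (t * sin_t z)) `|t| x y dcos) => z.
by rewrite normrN normrM ler_piMr//; exact: sin_max.
Qed.

Lemma riemann_cvg (f F : R -> R) :
  (forall x : R, is_derive x 1 F (f x)) -> continuous f ->
  (forall x y, `|f x - f y| <= `|t| * `|x - y|) ->
  (fun n => n.+1%:R^-1 * (\sum_(a < n.+1) f (a%:R / n.+1%:R))) @ \oo -->
    Rintegral U setT f.
Proof.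
move=> dF cf fl; rewrite /Rintegral (integral_uniform01 dF cf)/=.
apply/cvgrPdist_lt => e e0.
have /cvgrPdist_lt/(_ _ e0) := bound_cvg0 `|t|.
apply: filterS => n; rewrite sub0r normrN; apply: le_lt_trans.
rewrite distrC; apply: (le_trans (riemann_sum_bound dF fl n)); exact: ler_norm.
Qed.

Lemma cos_riemann :
  (fun n => n.+1%:R^-1 * (\sum_(a < n.+1) cos_t (a%:R / n.+1%:R))) @ \oo -->
    Rintegral U setT cos_t.
Proof.
(* for t <> 0 the primitive is sin (t u) / t *)
have [t0|t0] := eqVneq t 0.
  apply: (@riemann_cvg _ id); [|exact: cont dcos|exact: cos_lip].
  by move=> x; apply: is_derive_eq; rewrite /cos_t t0 mul0r cos0.
apply: (@riemann_cvg _ (t^-1 \*: sin_t)); [|exact: cont dcos|exact: cos_lip].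
move=> x; have H := dsin x.
by apply: is_derive_eq; rewrite /GRing.scale/= mulrA mulVf// mul1r.
Qed.

Lemma sin_riemann :
  (fun n => n.+1%:R^-1 * (\sum_(a < n.+1) sin_t (a%:R / n.+1%:R))) @ \oo -->
    Rintegral U setT sin_t.
Proof.
have [t0|t0] := eqVneq t 0.
  apply: (@riemann_cvg _ (cst 0)); [|exact: cont dsin|exact: sin_lip].
  by move=> x; apply: is_derive_eq; rewrite /sin_t t0 mul0r sin0.
apply: (@riemann_cvg _ (- t^-1 \*: cos_t)); [|exact: cont dsin|exact: sin_lip].
move=> x; have H := dcos x.
by apply: is_derive_eq; rewrite /GRing.scale/= mulrN mulNr opprK mulrA mulVf// mul1r.
Qed.

Lemma cintegrable_expi : cintegrable U (fun u => expi (t * u)).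
Proof.
split; apply: measurable_bounded_integrable => //.
- by apply: (le_lt_trans (probability_le1 U measurableT)); exact: ltry.
- by apply: continuous_measurable_fun; exact: cont dcos.
- by exists 1; split => // M M1 x _; apply: le_trans (cos_max _) (ltW M1).
- by apply: (le_lt_trans (probability_le1 U measurableT)); exact: ltry.
- by apply: continuous_measurable_fun; exact: cont dsin.
- by exists 1; split => // M M1 x _; apply: le_trans (sin_max _) (ltW M1).
Qed.

Lemma expi_riemann :
  (fun n => n.+1%:R^-1 * (\sum_(a < n.+1) expi (t * (a%:R / n.+1%:R)))) @ \oo -->
    (cexpectation U (fun u => expi (t * u)) : C^o).
Proof.
have E n : n.+1%:R^-1 * (\sum_(a < n.+1) expi (t * (a%:R / n.+1%:R))) =
    (n.+1%:R^-1 * (\sum_(a < n.+1) cos_t (a%:R / n.+1%:R))) +i*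
    (n.+1%:R^-1 * (\sum_(a < n.+1) sin_t (a%:R / n.+1%:R))) :> C.
  rewrite [RHS]complexE/= !rmorphM/= !fmorphV/= !rmorph_nat mulrCA -mulrDr.
  congr (_ * _); rewrite !rmorph_sum mulr_sumr -big_split/=.
  by apply: eq_bigr => a _; rewrite [LHS]complexE.
rewrite cexpectationE; under eq_fun do rewrite E.
by apply: cvg_complex; [exact: cos_riemann|exact: sin_riemann].
Qed.

End DiagonalMoments.

(** * Moments of the complex Gaussian variable *)

Section ComplexGaussian.
Variable R : realType.
Local Notation C := R[i].

Definition circ_word (bs : seq bool) : seq ('I_2 * bool) := [seq (ord0, b) | b <- bs].

Lemma circ_word_circ bs : all circ_letter (circ_word bs).
Proof. by rewrite all_map; apply/allP. Qed.

Lemma circ_count_word bs : circ_count (circ_word bs) = size bs.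
Proof. by rewrite /circ_count count_map -[RHS](count_predT bs); exact: eq_count. Qed.

(** A complex Gaussian variable and its conjugate are the combinations of its two
    real coordinates with these coefficients. *)
Definition coefficient (b : bool) (a : nat) : C :=
  if a == 0%N then 1 else (step b)%:~R * 'i%C.

Let coord (j : nat) (w : R * R) : R := if j == 0%N then w.1 else w.2.

Let letterE b (w : R * R) :
  (if b then Num.conj (w.1 +i* w.2) else w.1 +i* w.2) =
  \sum_(a < 2) (coord a w)%:C * coefficient b a.
Proof.
rewrite !big_ord_recl big_ord0 addr0 /coord /coefficient/= mulr1.
rewrite [in RHS]mulrC -mulrA; case: b.
  by rewrite [LHS]complexE/= rmorphN/= mulrN1z mulN1r mulrN.
by rewrite [LHS]complexE/= mul1r.
Qed.

Let wordE bs (w : R * R) :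
  \prod_(b <- bs) (if b then Num.conj (w.1 +i* w.2) else w.1 +i* w.2) =
  boxsum 2 (size bs) (fun s => (\prod_(a <- s) coord a w)%:C *
     \prod_(p <- zip bs s) coefficient p.1 p.2).
Proof.
elim: bs => [|b bs IH]; first by rewrite /= !big_nil mulr1.
rewrite big_cons IH letterE [RHS]/= mulr_suml; apply: eq_bigr => a _.
rewrite -boxsumMl; apply: eq_boxsum => s _ _.
by rewrite !big_cons rmorphM/=; ring.
Qed.

Let sigma : R := Num.sqrt 2^-1.
Let sigma0 : 0 < sigma. Proof. by rewrite sqrtr_gt0 invr_gt0. Qed.

Let normalT : normal_prob 0 sigma [set: R] = 1%E.
Proof. exact: (probability_setT (normal_prob 0 sigma)). Qed.

Let gauss2_rectangle (A B : set R) : measurable A -> measurable B ->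
  gauss2 (A `*` B) = (normal_prob 0 sigma A * normal_prob 0 sigma B)%E.
Proof. by move=> mA mB; exact: product_measure1E. Qed.

Let coord_indep (B : nat -> set R) : (forall j, measurable (B j)) ->
  gauss2 (\bigcap_(j in [set` iota 0 2]) (coord j @^-1` B j)) =
  (\prod_(j <- iota 0 2) gauss2 (coord j @^-1` B j))%E.
Proof.
move=> mB; rewrite /= !big_cons big_nil mule1.
have -> : \bigcap_(j in [set` [:: 0; 1]%N]) (coord j @^-1` B j) = B 0%N `*` B 1%N.
  apply/seteqP; split=> [[x y] H|[x y] [/= H0 H1] j /=].
    by split; [have := H 0%N isT|have := H 1%N isT].
  by rewrite !inE => /orP[] /eqP ->.
have -> : coord 0 @^-1` B 0%N = B 0%N `*` setT.
  by apply/seteqP; split=> [[x y]|[x y] []].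
have -> : coord 1 @^-1` B 1%N = setT `*` B 1%N.
  by apply/seteqP; split=> [[x y]|[x y] []].
by rewrite !gauss2_rectangle// normalT mule1 mul1e.
Qed.

Let coord_law j (B : set R) : measurable B ->
  gauss2 (coord j @^-1` B) = normal_prob 0 sigma B.
Proof.
move=> mB; case: j => [|j].
  have -> : coord 0 @^-1` B = B `*` setT.
    by apply/seteqP; split=> [[x y]|[x y] []].
  by rewrite gauss2_rectangle// normalT mule1.
have -> : coord j.+1 @^-1` B = setT `*` B.
  by apply/seteqP; split=> [[x y]|[x y] []].
by rewrite gauss2_rectangle// normalT mul1e.
Qed.

Let coord_measurable j : measurable_fun setT (coord j).
Proof. by case: j => [|j]; [exact: measurable_fst|exact: measurable_snd]. Qed.

Lemma final_form_circ bs L q p : size q = size bs ->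
  final_form (circ_word bs) L q p =
  L p + \sum_(x <- zip bs q | x.2 == p) step x.1.
Proof.
elim: bs L q => [|b bs IH] L [|r q]//=; first by rewrite big_nil addr0.
move=> -[qs]; rewrite IH// big_cons/= /bump_form (eq_sym p).
by case: ifP => _; rewrite ?addr0// addrA.
Qed.

Let prod_nat_all (b : pred nat) h : (\prod_(p < h) b p)%N = all b (iota 0 h).
Proof.
elim: h => [|h IH]; first by rewrite big_ord0.
by rewrite -[in RHS]addn1 iotaD all_cat big_ord_recr/= IH mulnb andbT.
Qed.

(** Summing over the two coordinates, a pair of letters with steps e and e'
    contributes 1/2 (1 + (e iota) (e' iota)) = 1/2 (1 - e e'), which is 1 if the
    steps are opposite and 0 if they are equal. *)
Lemma pairing_weight bs (q : seq nat) : q \in pairings (size bs) ->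
  (sigma ^+ 2)%:C ^+ (size bs)./2 * boxsum 2 (size bs)./2 (fun u =>
    \prod_(x <- zip bs (map (nth 0%N u) q)) coefficient x.1 x.2) =
  (balanced (circ_word bs) q)%:R.
Proof.
move=> qK; have [qs _] := pairings_size qK.
set h := (size bs)./2.
pose G (p a : nat) : C := \prod_(x <- zip bs q | x.2 == p) coefficient x.1 a.
rewrite (@eq_boxsum _ 2 h _ (fun u => \prod_(p < h) G p (nth 0%N u p))); last first.
  move=> u _ _; rewrite (_ : zip bs (map (nth 0%N u) q) =
      [seq (x.1, nth 0%N u x.2) | x <- zip bs q]); last first.
    by elim: (bs) (q) => [|b s IH] [|r q']//=; rewrite IH.
  rewrite big_map/= big_seq.
  have below_q x : x \in zip bs q -> (x.2 < h)%N.
    move=> xz; have := pairings_below qK => /allP; apply.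
    by rewrite -(unzip2_zip (s := bs) (t := q)) ?qs// map_f.
  (* [inord] requires at least one pair *)
  rewrite -big_seq; case: h below_q => [|h'] below_q.
    rewrite big_ord0 big_seq big1// => x /below_q; by rewrite ltn0.
  rewrite big_seq (partition_big (fun x => inord x.2 : 'I_h'.+1) xpredT)//=.
  apply: eq_bigr => p _; rewrite /G [RHS]big_seq_cond; apply: eq_big => x.
    have [xz|//] := boolP (x \in _); rewrite /= -val_eqE/= inordK//.
    exact: below_q.
  by move=> /andP[xz /eqP <-]; rewrite inordK// below_q.
rewrite boxsum_prod.
have -> : (sigma ^+ 2)%:C = 2^-1 :> C.
  by rewrite sqr_sqrtr ?invr_ge0// fmorphV rmorph_nat.
rewrite -[X in _ ^+ X]card_ord -prodr_const -big_split/=.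
rewrite /balanced circ_count_word -/h.
transitivity (\prod_(p < h) (closing (circ_word bs) q p == 0)%:R : C).
  apply: eq_bigr => p _; rewrite /closing final_form_circ// add0r.
  have : size [seq x <- zip bs q | x.2 == val p] = 2%N.
    rewrite size_filter -(count_map snd (pred1 (val p))) -/(unzip2 _).
    by rewrite unzip2_zip ?qs// (pairings_count _ qK) ltn_ord.
  rewrite !big_ord_recl big_ord0 addr0 /G -!(big_filter _ (fun x => x.2 == val p)).
  case: [seq x <- _ | _] => [|[b1 r1] [|[b2 r2] []]]//= _.
  rewrite !big_cons !big_nil /coefficient/= !mulr1 addr0.
  rewrite mulrACA -expr2 sqr_i mulrN1 -rmorphM/=.
  by case: b1; case: b2 => /=; field.
by rewrite -natr_prod (prod_nat_all (fun p => closing (circ_word bs) q p == 0)).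
Qed.

(** Wick's formula for the two real coordinates, of variance 1/2, where
    [pairing_weight] evaluates the contribution of each pairing. *)
Theorem complex_gaussian_moment bs :
  cexpectation (@gauss2 R) (fun w =>
    \prod_(b <- bs) (if b then Num.conj (w.1 +i* w.2) else w.1 +i* w.2)) =
  \sum_(q <- pairings (size bs)) (balanced (circ_word bs) q)%:R.
Proof.
under [X in cexpectation _ X]eq_fun do rewrite wordE.
apply: (etrans (@gaussian_wick _ _ R
  (normal_prob (0 : R) sigma \x normal_prob (0 : R) sigma)%E coord 2 sigma sigma0
  coord_measurable coord_law coord_indep (size bs)
  (fun s => \prod_(p <- zip bs s) coefficient p.1 p.2))).
rewrite mulr_sumr big_seq [RHS]big_seq; apply: eq_bigr => q qK.
exact: pairing_weight.
Qed.

End ComplexGaussian.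

(** * The limit space *)

Definition word : Type := seq ('I_2 * bool).
HB.instance Definition _ := Choice.on word.

Section WordMonoid.

Let word_unit (x y : word) : x ++ y = [::] -> x = [::] /\ y = [::].
Proof. by case: x. Qed.

HB.instance Definition _ := Choice_isMonomialDef.Build word
  (@catA ('I_2 * bool)%type) (@cat0s ('I_2 * bool)%type) (@cats0 ('I_2 * bool)%type)
  word_unit.

Let flip (l : 'I_2 * bool) := (l.1, ~~ l.2).
Definition word_star (x : word) : word := rev (map flip x).

Let word_starK : involutive word_star.
Proof.
move=> x; rewrite /word_star map_rev revK -map_comp.
by apply: map_id_in => -[i b] _ /=; rewrite /flip/= negbK.
Qed.

Let word_starM (x y : word) : word_star (mmul x y) = mmul (word_star y) (word_star x).
Proof. by rewrite /word_star [mmul x y]/(x ++ y) map_cat rev_cat. Qed.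

HB.instance Definition _ := isStarMonomial.Build word word_starK word_starM.

End WordMonoid.

(** The pair (k, l) stands for the k-th power of a normal element times the l-th
    power of its adjoint. *)
Definition exponents : Type := (nat * nat)%type.
HB.instance Definition _ := Choice.on exponents.

Section ExponentMonoid.

Definition exp_mul (x y : exponents) : exponents := ((x.1 + y.1)%N, (x.2 + y.2)%N).

Let exp_mulA : associative exp_mul.
Proof. by move=> x y z; rewrite /exp_mul/= !addnA. Qed.
Let exp_mul1 : left_id (0, 0)%N exp_mul.
Proof. by case. Qed.
Let exp_mulr1 : right_id (0, 0)%N exp_mul.
Proof. by case=> a b; rewrite /exp_mul/= !addn0. Qed.
Let exp_unit (x y : exponents) : exp_mul x y = (0, 0)%N ->
  x = (0, 0)%N /\ y = (0, 0)%N.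
Proof. by case: x y => [[|?] [|?]] [[|?] [|?]]. Qed.

HB.instance Definition _ := Choice_isMonomialDef.Build exponents
  exp_mulA exp_mul1 exp_mulr1 exp_unit.

Definition exp_star (x : exponents) : exponents := (x.2, x.1).
Let exp_starK : involutive exp_star. Proof. by case. Qed.
Let exp_starM x y : exp_star (mmul x y) = mmul (exp_star y) (exp_star x).
Proof. by rewrite /exp_star/mmul/= /exp_mul/= addnC [X in (_, X)]addnC. Qed.

HB.instance Definition _ := isStarMonomial.Build exponents exp_starK exp_starM.

End ExponentMonoid.

Section ModelSpace.
Variable R : realType.
Local Notation C := R[i].

Definition diag_word (bs : seq bool) : word := [seq (@Ordinal 2 1 isT, b) | b <- bs].

Lemma gen_word (Q : word) :
  \prod_(l <- Q) (if l.2 then star (tnth [tuple gen C ([:: (ord0, false)] : word);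
       gen C ([:: (@Ordinal 2 1 isT, false)] : word)] l.1)
     else tnth [tuple gen C ([:: (ord0, false)] : word);
       gen C ([:: (@Ordinal 2 1 isT, false)] : word)] l.1) = gen C Q.
Proof.
elim: Q => [|[i b] Q IH]; first by rewrite big_nil -gen1.
rewrite big_cons IH.
rewrite (_ : (if _ then _ else _) = gen C ([:: (i, b)] : word)) ?genM//.
have [->|i0] := eqVneq i ord0; first by case: b; rewrite //= star_gen.
have -> : i = @Ordinal 2 1 isT by apply/val_inj; case: i i0 => -[|[|]].
by case: b; rewrite //= star_gen.
Qed.

End ModelSpace.

Section GaussianSpace.
Variable R : realType.
Local Notation C := R[i].
Local Notation z w := (w.1 +i* w.2).

Definition gaussian_tau (x : exponents) : C :=
  cexpectation (@gauss2 R) (fun w => z w ^+ x.1 * Num.conj (z w) ^+ x.2).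

Lemma gaussian_tau1 : gaussian_tau mone = 1.
Proof.
transitivity (cexpectation (@gauss2 R) (fun w =>
    \prod_(b <- [::]) (if b then Num.conj (z w) else z w))).
  by congr cexpectation; apply/funext => w; rewrite big_nil !expr0 mulr1.
by rewrite complex_gaussian_moment big_seq1.
Qed.

Definition gaussian_space : ncProbSpace C := monoid_space gaussian_tau1.

Definition gaussian_elt : gaussian_space := gen C ((1, 0)%N : exponents).

Let starg : star gaussian_elt = gen C ((0, 1)%N : exponents).
Proof. exact: star_gen. Qed.

Let gX (x : exponents) k : gen C x ^+ k = gen C ((x.1 * k, x.2 * k)%N : exponents).
Proof.
elim: k => [|k IH]; first by rewrite !muln0 expr0 -gen1.
by rewrite exprS IH genM /mmul/= /exp_mul/= !mulnS.
Qed.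

Lemma gaussian_eltP : std_complex_gaussian gaussian_elt.
Proof.
split; first by rewrite /normal_elt starg /gaussian_elt !genM.
move=> k l; rewrite starg /gaussian_elt !gX genM.
by rewrite [LHS]linear_extension_gen /mmul/= /exp_mul/= !mul0n !mul1n addn0.
Qed.

Lemma gaussian_elt_moment (m : monomial C 1) :
  state gaussian_space (meval m [tuple gaussian_elt]) =
  m.1 * \sum_(q <- pairings (size m.2)) (balanced (circ_word (map snd m.2)) q)%:R.
Proof.
case: m => k Q; rewrite /meval linearZ/=; congr (_ * _).
rewrite (_ : \prod_(l <- Q) _ = gen C ((count (fun l => ~~ l.2) Q,
    count (fun l => l.2) Q) : exponents)); last first.
  elim: Q => [|[i b] Q IH]; first by rewrite big_nil -gen1.
  rewrite big_cons IH (ord1 i); case: b => /=.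
    by rewrite [tnth _ _]/= starg genM.
  by rewrite [tnth _ _]/= genM.
rewrite [LHS]linear_extension_gen /gaussian_tau/=.
rewrite -(size_map snd) -complex_gaussian_moment; congr cexpectation.
apply/funext => w; rewrite big_map; elim: Q => [|[i b] Q IH].
  by rewrite big_nil !expr0 mulr1.
by rewrite big_cons -IH; case: b => /=; rewrite add0n add1n exprS;
  [rewrite mulrCA|rewrite mulrA].
Qed.

End GaussianSpace.

Section DiagonalWords.
Variables (R : realType) (theta : R).
Local Notation C := R[i].

Lemma circ_count_diag bs : circ_count (diag_word bs) = 0%N.
Proof. by rewrite /circ_count count_map; elim: bs. Qed.

Lemma ending_diag bs z s : ending (diag_word bs) z s = z.
Proof. by elim: bs. Qed.

Definition winding (bs : seq bool) : R := (\sum_(b <- bs) step b)%:~R * theta.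

Lemma prod_wave bs x : \prod_(b <- bs) wave theta b x = expi (winding bs * x).
Proof.
elim: bs => [|b bs IH]; first by rewrite !big_nil /winding big_nil !mul0r expi0.
rewrite big_cons IH /wave -expiD; congr expi.
rewrite /winding big_cons rmorphD/= !mulrDl; congr (_ + _).
by case: b; rewrite /= ?mulN1r ?mul1r// mulrN1z mulN1r.
Qed.

Lemma phase_diag n bs z s : phase theta n (diag_word bs) z s =
  expi (winding bs * circpos R n z).
Proof.
by rewrite -prod_wave; elim: bs => [|b bs IH]; rewrite ?big_nil// big_cons -IH.
Qed.

(** The only pairing is the empty one, and the walk does not move: the average
    over its starting point is a Riemann sum. *)
Lemma pair_term_diag bs :
  (fun n => pair_term theta (diag_word bs) [::] n.+1) @ \oo -->
  (cexpectation (uniform01 R) (fun u => expi (winding bs * u)) : C^o).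
Proof.
have E n : pair_term theta (diag_word bs) [::] n.+1 =
    n.+1%:R^-1 * (\sum_(a < n.+1) expi (winding bs * (a%:R / n.+1%:R))).
  rewrite /pair_term circ_count_diag/= expn1; congr (_ * _).
  apply: eq_bigr => a _; rewrite phase_diag ending_diag resid_small//.
  by rewrite eqxx mulr1 /circpos resid_small.
by under eq_fun do rewrite E; exact: expi_riemann.
Qed.

Lemma meval_expi (m : monomial C 1) u :
  meval m [tuple expi (theta * u) : C^o] = m.1 * expi (winding (map snd m.2) * u).
Proof.
rewrite /meval -[_ *: _]/(_ * _); congr (_ * _).
rewrite -prod_wave big_map; apply: eq_bigr => -[i b] _; rewrite (ord1 i) /=.
case: b => //=; rewrite -[LHS]/(Num.conj (expi (theta * u))) conj_expi.
by rewrite /wave mulNr.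
Qed.

End DiagonalWords.

Theorem theorem2p1 (R : realType) (disp : measure_display)
    (T : measurableType disp) (P : probability T R)
    (c : nat -> {RV P >-> R})
    (c_indep : mutually_independent c)
    (c_gauss : forall j, standard_gaussian (c j))
    (theta : R) (theta_itv : - pi <= theta <= pi) :
  exists (A : ncProbSpace R[i]) (N dtheta : A),
  [/\ forall Q : monomial R[i] 2,
        (fun n => phi P (fun w => meval Q
           [tuple (Num.sqrt n.+1%:R)^-1%:C *: circ n.+1 (fun j => c j w);
                  Dmx n.+1 theta])) @ \oo
        --> (state A (meval Q [tuple N; dtheta]) : R[i]^o),
      exists (B : ncProbSpace R[i]) (g : B),
        std_complex_gaussian g /\
        forall m : monomial R[i] 1,
          state A (meval m [tuple N]) = state B (meval m [tuple g])
    & forall m : monomial R[i] 1,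
        state A (meval m [tuple dtheta]) =
        cexpectation (uniform01 R)
          (fun u => meval m [tuple expi (theta * u) : R[i]^o])].
Proof.
pose S (w : word) n := \sum_(q <- pairings (circ_count w)) pair_term theta w q n.+1.
have S_cvg w : exists l : R[i], S w @ \oo --> (l : R[i]^o).
  have l_ex (q : seq nat) : exists l : R[i], q \in pairings (circ_count w) ->
      (fun n => pair_term theta w q n.+1) @ \oo --> (l : R[i]^o).
    have [qK|] := boolP (q \in pairings (circ_count w)); last by exists 0.
    by have [l lP] := pair_term_cvg theta qK; exists l.
  have [l lP] := choice l_ex.
  by exists (\sum_(q <- pairings (circ_count w)) l q); exact: cvgC_sum.
have [tau tauP] := choice S_cvg.
(* on the words in one of the two letters the limits are known *)
have tau_circ (bs : seq bool) :
    tau (circ_word bs) = \sum_(q <- pairings (size bs)) (balanced (circ_word bs) q)%:R.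
  apply: cvgC_unique (tauP (circ_word bs)) _; rewrite -(circ_count_word bs).
  by apply: cvgC_sum => q qK; apply: pair_term_circ => //; exact: circ_word_circ.
have tau_diag bs : tau (diag_word bs) =
    cexpectation (uniform01 R) (fun u => expi (winding theta bs * u)).
  apply: cvgC_unique (tauP (diag_word bs)) _.
  rewrite /S circ_count_diag; under eq_fun do rewrite big_seq1.
  exact: pair_term_diag.
have tau1 : tau mone = 1 by have := tau_circ [::]; rewrite big_seq1.
pose A := monoid_space tau1.
pose N : A := gen R[i] ([:: (ord0, false)] : word).
pose d : A := gen R[i] ([:: (@Ordinal 2 1 isT, false)] : word).
have stateE k (w : word) : state A (k *: gen R[i] w) = k * tau w.
  by rewrite linearZ/=; congr (_ * _); exact: linear_extension_gen.
exists A, N, d; split.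
- move=> Q; under eq_fun do rewrite (phi_word _ c_indep c_gauss).
  rewrite /meval gen_word stateE; apply: cvgC_scale; exact: tauP.
- exists (gaussian_space R), (gaussian_elt R); split; first exact: gaussian_eltP.
  move=> m; rewrite gaussian_elt_moment -(size_map snd) -tau_circ -stateE.
  rewrite /meval; congr (state _ (_ *: _)); rewrite -gen_word big_map big_map.
  by apply: eq_bigr => -[i b] _; rewrite /= (ord1 i).
- move=> m; under [X in cexpectation _ X]eq_fun do rewrite meval_expi.
  rewrite cexpectationZ; last exact: cintegrable_expi.
  rewrite -tau_diag -stateE /meval; congr (state _ (_ *: _)).
  rewrite -gen_word big_map big_map.
  by apply: eq_bigr => -[i b] _; rewrite /= (ord1 i).
Qed.
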